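(* Let $V$ be a finite dimensional Euclidean Jordan algebra with inner product $(v|w)=\mathrm{tr}(v\circ w)$. Then $\mathrm{Str}(V)$ admits the left-invariant Riemannian metric $$\langle A,B\rangle_g=\tfrac12\mathrm{Tr}\big(g^{-1}A\,(g^{-1}B)^{\dagger}+g^{-1}B\,(g^{-1}A)^{\dagger}\big),\qquad g\in\mathrm{Str}(V),\ A,B\in T_g\mathrm{Str}(V),$$ or equivalently $$\langle g(L_x+D),g(L_y+\widetilde D)\rangle_g=\mathrm{Tr}(L_xL_y)-\mathrm{Tr}(D\widetilde D),\qquad x,y\in V,\ D,\widetilde D\in\mathrm{Der}(V).$$ The connection $\nabla$ on $\mathrm{Str}(V)$ induced by the quadratic spray $F_g(gH)=g(H^2+H^{\dagger}H-HH^{\dagger})$, $g\in\mathrm{Str}(V)$, $H\in\mathfrak{str}(V)$, is the Levi-Civita connection of this metric.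
   Context: A finite dimensional Euclidean Jordan algebra is a finite dimensional real commutative unital algebra $(V,\circ)$ satisfying $x^2\circ(x\circ y)=x\circ(x^2\circ y)$, for which $(v|w)=\mathrm{tr}(v\circ w)$ is a positive definite inner product; here $L_xy=x\circ y$, $\mathrm{tr}(x)=\mathrm{Tr}(L_x)$, and $\mathrm{Tr}$ is the usual trace of linear operators on $V$. $U_x=2L_x^2-L_{x^2}$. The structure group $\mathrm{Str}(V)$ is the set of $g\in GL(V)$ for which there is $g^*\in GL(V)$ with $U_{gx}=gU_xg^*$ for all $x\in V$; it is a Lie subgroup of $GL(V)$ with Lie algebra $\mathfrak{str}(V)=\mathbb L\oplus\mathrm{Der}(V)$, where $\mathbb L=\{L_x:x\in V\}$ and $\mathrm{Der}(V)$ is the space of derivations of $V$. $T_g\mathrm{Str}(V)=g\,\mathfrak{str}(V)$. For $H=L_x+D\in\mathfrak{str}(V)$, $H^{\dagger}=L_x-D$. The connection induced by a quadratic spray $F$ is the torsion-free one with $\nabla_XY=DY(X)-\Gamma(X,Y)$ where $\Gamma$ is the polarization of $F$; its covariant derivative along a path $\gamma$ is $D_t\mu=\mu'-\Gamma_\gamma(\gamma',\mu)$. Here $\Gamma_g(gH,gK)=\tfrac12 g(HK+KH+H^{\dagger}K+K^{\dagger}H-HK^{\dagger}-KH^{\dagger})$. *)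

(* Defs.v *)
From HB Require Import structures.
From mathcomp Require Import all_boot all_order all_algebra.
From mathcomp Require Import all_classical all_reals all_analysis.

Set Implicit Arguments.
Unset Strict Implicit.
Unset Printing Implicit Defensive.

Import Order.TTheory GRing.Theory Num.Theory.
Import numFieldNormedType.Exports passmx.

Local Open Scope classical_set_scope.
Local Open Scope ring_scope.

(* The library puts no topology on spaces of linear maps.  We use the max norm
   of the coordinates; all norms on a finite dimensional space are equivalent,
   so differentiability and smoothness do not depend on this choice. *)
Section HomNorm.
Variables (R : realType) (aT rT : vectType R).

Definition hom_norm (f : 'Hom(aT, rT)) : R :=
  `|rVof (vbasis {:'Hom(aT, rT)}) f|.

Lemma ler_hom_normD f g : hom_norm (f + g) <= hom_norm f + hom_norm g.
Proof. by rewrite /hom_norm raddfD ler_normD. Qed.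

Lemma hom_normZ (a : R) f : hom_norm (a *: f) = `|a| * hom_norm f.
Proof. by rewrite /hom_norm linearZ normrZ. Qed.

Lemma hom_norm_eq0 f : hom_norm f = 0 -> f = 0.
Proof.
move/normr0_eq0 => f0; apply: (can_inj (rVofK (vbasisP fullv))).
by rewrite f0 raddf0.
Qed.

HB.instance Definition _ := Lmodule_isNormed.Build R 'Hom(aT, rT)
  ler_hom_normD hom_normZ hom_norm_eq0.

End HomNorm.

Section Smooth.
Variables (R : realType) (E W : normedModType R).

Fixpoint Ck_on (k : nat) (U : set E) (f : E -> W) : Prop :=
  if k is k'.+1 then
    (forall x, U x -> differentiable f x) /\ (forall v, Ck_on k' U ('D_v f))
  else forall x, U x -> {for x, continuous f}.

(* meant for open U and finite dimensional E *)
Definition smooth_on (U : set E) (f : E -> W) := forall k, Ck_on k U f.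

(* Smoothness of a function defined on an embedded submanifold M only: it has
   a smooth extension to a neighbourhood in E of every point of M. *)
Definition smooth (M : set E) (f : M -> W) :=
  forall p : M, exists U : set E, exists g : E -> W,
    [/\ open U, U (val p), smooth_on U g
      & forall q : M, U (val q) -> f q = g (val q)].

(* The derivative of f at p along the tangent vector v, i.e. the velocity at 0
   of f \o c for any curve c in M with c 0 = p and c'(0) = v. *)
Definition tderive (M : set E) (f : M -> W) (p : M) (v : E) : W :=
  xget 0 [set w | forall c : R -> M, c 0 = p ->
    is_derive (0 : R) 1 (fun t => val (c t)) v ->
    is_derive (0 : R) 1 (fun t => f (c t)) w].

End Smooth.

(* M is an embedded submanifold of E and T p is its tangent space at p.  Vector
   fields along M are functions defined on M only. *)
Section Geometry.
Variables (R : realType) (E : normedModType R) (M : set E) (T : M -> set E).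
Implicit Types (X Y Z : M -> E) (m : M -> E -> E -> R).

Definition vector_field X := smooth X /\ forall p, T p (X p).

Definition riemannian_metric m :=
  [/\ forall p (a : R) u v w, T p u -> T p v -> T p w ->
        m p (a *: u + v) w = a * m p u w + m p v w,
      forall p u v, T p u -> T p v -> m p u v = m p v u,
      forall p u, T p u -> u != 0 -> 0 < m p u u
    & forall X Y, vector_field X -> vector_field Y ->
        smooth (fun p => m p (X p) (Y p))].

Definition affine_connection (nabla : (M -> E) -> (M -> E) -> M -> E) :=
  [/\ forall X Y, vector_field X -> vector_field Y ->
        vector_field (nabla X Y),
      forall (f : M -> R) X X' Y, smooth f ->
        vector_field X -> vector_field X' -> vector_field Y ->
        forall p, nabla (fun q => f q *: X q + X' q) Y p =
                  f p *: nabla X Y p + nabla X' Y p,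
      forall X Y Y',
        vector_field X -> vector_field Y -> vector_field Y' ->
        forall p, nabla X (fun q => Y q + Y' q) p = nabla X Y p + nabla X Y' p
    & forall (f : M -> R) X Y, smooth f ->
        vector_field X -> vector_field Y ->
        forall p, nabla X (fun q => f q *: Y q) p =
                  tderive f p (X p) *: Y p + f p *: nabla X Y p].

Definition lie_bracket X Y : M -> E :=
  fun p => tderive Y p (X p) - tderive X p (Y p).

Definition torsion_free (nabla : (M -> E) -> (M -> E) -> M -> E) :=
  forall X Y, vector_field X -> vector_field Y ->
  forall p, nabla X Y p - nabla Y X p = lie_bracket X Y p.

Definition metric_compatible m (nabla : (M -> E) -> (M -> E) -> M -> E) :=
  forall X Y Z, vector_field X -> vector_field Y -> vector_field Z ->
  forall p, tderive (fun q => m q (Y q) (Z q)) p (X p) =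
            m p (nabla X Y p) (Z p) + m p (Y p) (nabla X Z p).

Definition levi_civita m (nabla : (M -> E) -> (M -> E) -> M -> E) :=
  [/\ affine_connection nabla, torsion_free nabla & metric_compatible m nabla].

Definition polarization (F : M -> E -> E) (p : M) (u v : E) : E :=
  2^-1 *: (F p (u + v) - F p u - F p v).

Definition spray_connection (F : M -> E -> E) X Y : M -> E :=
  fun p => tderive Y p (X p) - polarization F p (X p) (Y p).

End Geometry.

Section Jordan.
Variables (R : realType) (V : vectType R) (jmul : V -> V -> V) (e : V).
Implicit Types (x y : V) (f g h D H K A B : 'End(V)).

Definition lfun_trace f : R :=
  \sum_(i < \dim {:V}) coord (vbasis {:V}) i (f (vbasis {:V})`_i).

Definition jL x : 'End(V) := linfun (jmul x).

Definition jtr x : R := lfun_trace (jL x).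

Definition euclidean_jordan_algebra :=
  [/\ forall x, linear (jmul x),
      commutative jmul,
      right_id e jmul,
      forall x y, jmul (jmul x x) (jmul x y) = jmul x (jmul (jmul x x) y)
    & forall x, x != 0 -> 0 < jtr (jmul x x)].

Definition jU x : 'End(V) := 2 *: (jL x \o jL x)%VF - jL (jmul x x).

Definition GL : set 'End(V) := [set g | lker g == 0%VS].

Definition Str : set 'End(V) :=
  [set g | GL g /\
    exists2 gs, GL gs & forall x, jU (g x) = (g \o (jU x \o gs))%VF].

Definition Der : set 'End(V) :=
  [set D | forall x y, D (jmul x y) = jmul (D x) y + jmul x (D y)].

Definition str : set 'End(V) := [set H | exists x, exists2 D, Der D & H = jL x + D].

Definition tangent_Str (g : Str) : set 'End(V) :=
  [set A | exists2 H, str H & A = (val g \o H)%VF].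

(* If H = jL x + D with D a derivation, then D e = 0, hence x = H e; see
   dagger_LD. *)
Definition dagger H : 'End(V) := jL (H e) - (H - jL (H e)).

Definition metric_Str (g : Str) A B : R :=
  let H := ((val g)^-1 \o A)%VF in let K := ((val g)^-1 \o B)%VF in
  2^-1 * lfun_trace ((H \o dagger K) + (K \o dagger H))%VF.

Definition spray_Str (g : Str) A : 'End(V) :=
  let H := ((val g)^-1 \o A)%VF in
  (val g \o ((H \o H) + (dagger H \o H) - (H \o dagger H)))%VF.

Definition left_invariant (m : Str -> 'End(V) -> 'End(V) -> R) :=
  forall h g k : Str, val k = (val h \o val g)%VF ->
  forall A B, tangent_Str g A -> tangent_Str g B ->
  m k (val h \o A)%VF (val h \o B)%VF = m g A B.

Lemma jLE (VJ : euclidean_jordan_algebra) x y : jL x y = jmul x y.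
Proof.
case: VJ => linM _ _ _ _.
pose lM := GRing.isLinear.Build R V V *:%R (jmul x) (linM x).
pose l : {linear V -> V} := HB.pack (jmul x) lM.
exact: (lfunE l).
Qed.

Lemma dagger_LD (VJ : euclidean_jordan_algebra) x D :
  Der D -> dagger (jL x + D) = jL x - D.
Proof.
case: (VJ) => _ comM idM _ _ DD.
have De : D e = 0.
  have := DD e e; rewrite idM [jmul e (D e)]comM idM => /eqP.
  by rewrite -subr_eq0 opprD addNKr oppr_eq0 => /eqP.
by rewrite /dagger add_lfunE jLE// idM De addr0 addrAC subrr add0r.
Qed.

Lemma daggerD (VJ : euclidean_jordan_algebra) H K :
  dagger (H + K) = dagger H + dagger K.
Proof.
have jLD x y : jL (x + y) = jL x + jL y.
  apply/lfunP => z; case: (VJ) => linM comM _ _ _.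
  rewrite add_lfunE !jLE// ![jmul _ z]comM.
  by have := linM z 1 x y; rewrite !scale1r.
rewrite /dagger add_lfunE jLD !opprB opprD.
by rewrite (addrACA (jL (H e)) _ (- H)) [LHS]addrACA.
Qed.

Lemma polarization_spray_Str (VJ : euclidean_jordan_algebra) (g : Str) H K :
  polarization spray_Str g (val g \o H)%VF (val g \o K)%VF =
  2^-1 *: (val g \o ((H \o K) + (K \o H) + (dagger H \o K) + (dagger K \o H)
                     - (H \o dagger K) - (K \o dagger H)))%VF.
Proof.
have gK A : ((val g)^-1 \o (val g \o A))%VF = A.
  by case: g => g /= /set_mem[gi _]; exact: lker0_compKf.
pose b A B := ((A \o B) + (dagger A \o B) - (A \o dagger B))%VF.
have bDl A B C : b (A + B) C = b A C + b B C.
  rewrite /b daggerD// !(comp_lfunDl A B) (comp_lfunDl (dagger A)) opprD.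
  by rewrite (addrACA (A \o C)%VF) [LHS]addrACA.
have bDr A B C : b C (A + B) = b C A + b C B.
  rewrite /b daggerD// !(comp_lfunDr _ A B) (comp_lfunDr _ (dagger A)) opprD.
  by rewrite (addrACA (C \o A)%VF) [LHS]addrACA.
rewrite /polarization /spray_Str -comp_lfunDr !gK -!/(b _ _).
rewrite -!comp_lfunNr -!comp_lfunDr; congr (_ *: (_ \o _)%VF).
rewrite bDl !bDr addrA [LHS]addrAC addrK -(addrA (b H H) (b H K)).
rewrite [LHS]addrAC subrr add0r.
rewrite /b !comp_lfunNr addrACA -opprD opprD !addrA; congr (_ - _ - _).
by rewrite -!addrA; congr (_ + _); rewrite addrCA.
Qed.

End Jordan.

(* Main.v *)
From HB Require Import structures.
Require Import Defs.
From mathcomp Require Import all_boot all_order all_algebra.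
From mathcomp Require Import all_classical all_reals all_analysis.
From mathcomp Require Import ring lra.
Import Order.TTheory GRing.Theory Num.Theory.
Import numFieldNormedType.Exports passmx.

Set Implicit Arguments.
Unset Strict Implicit.
Unset Printing Implicit Defensive.

Local Open Scope classical_set_scope.
Local Open Scope ring_scope.

(** A tangent vector of Str(V) at g is g o H with H in str(V), and the metric
    only sees H: it is the form B(H, K) = Tr(H K^dag + K H^dag) / 2 on str(V).
    So everything is computed after left translation.  If the curve c passes
    through g with velocity X(g) = g o H, and Y(g) = g o K, then
    c^-1 o Y(c) has a derivative K' with Y(c)' = g o (H K + K'), whence
    nabla_X Y = g o (K' + a(H, K)) with
    a(H, K) = ([H, K] - [H^dag, K] - [K^dag, H]) / 2.  The claims about nabla
    become claims about str(V):
    - nabla_X Y is tangent because str(V) is a Lie algebra stable under the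
      dagger (str_lie, which rests on Der_lie_jL: [L_x, L_y] is a derivation),
      and because str(V) is cut out by linear equations (strP), so that K' lies
      in it (is_derive_str);
    - nabla is compatible with the metric because a(H, .) is skew for B
      (str_form_skew).  This is cyclicity of the trace: writing H = P + D and
      K = Q + E along str(V) = L + Der(V), the only terms of B(a(H, K), K)
      that do not vanish one by one are Tr([E, P] Q) and Tr([P, Q] E), which
      are equal and occur with opposite signs;
    - torsion-freeness is the symmetry of the polarized spray.

    The form B is positive definite since L_x is self-adjoint and D skew for
    tr(v o w): hence Tr(L_x L_x) - Tr(D D) is a sum of squared norms
    (lfun_trace_adjoint, lfun_trace_str_gt0).

    The derivative of a function defined on Str(V) only is specified by its
    values along curves, so a curve with every prescribed tangent vector is
    needed for it to be determined.  The curve g o exp(tH) serves: it stays in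
    Str(V) by jU_lfun_exp, which integrates the infinitesimal identity
    2 U(H y, y) = H U_y + U_y H^dag (str_jU).  Smoothness of the metric and of
    nabla follows from smoothness of inversion on GL(V) (Ck_on_inv), since all
    other operations involved are bilinear on finite dimensional spaces
    (Ck_on_bilinear, bounded_bilinear_Hom). *)

(** * Differential calculus of bilinear maps *)

(** Packages a map known to be linear, so that the theory of linear maps
    applies to it. *)
Lemma linear_pack (R : realType) (U W : lmodType R) (F : U -> W) : linear F ->
  exists l : {linear U -> W}, forall x, l x = F x.
Proof.
move=> lF; pose lM := GRing.isLinear.Build R U W *:%R F lF.
by exists (HB.pack_for {linear U -> W} F lM).
Qed.

Section Calculus.
Variable R : realType.
Implicit Types E W : normedModType R.

(** Differentiability is defined through a differential picked by choice; this
    criterion takes a candidate L and an explicit estimate instead. *)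
Lemma is_diff_near E W (f : E -> W) (L : {linear E -> W}) x : continuous L ->
  (forall eps, 0 < eps ->
     \forall h \near (0 : E), `|f (h + x) - f x - L h| <= eps * `|h|) ->
  is_diff x f L.
Proof.
move=> Lc fL; have fE : f \o shift x = cst (f x) + L +o_ 0 id.
  apply/eqaddoP => eps eps0; near=> h => /=.
  by rewrite opprD addrA; near: h; exact: fL.
have dE := diff_unique Lc fE.
by split=> //; apply/diff_locallyP; rewrite dE.
Unshelve. all: by end_near. Qed.

Lemma near_eq_is_diff E W (f g : E -> W) x : (\near x, f x = g x) ->
  differentiable f x -> is_diff x g ('d f x).
Proof.
move=> fg df; apply: is_diff_near => [|eps eps0]; first exact: diff_continuous.
have /diff_locallyP[_ /eqaddoP /(_ _ eps0)] := df.
have : \forall h \near (0 : E), f (h + x) = g (h + x).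
  by move: fg; rewrite (near_shift 0) /= subr0.
apply: filter_app2; near=> h => <- /=.
by rewrite opprD addrA (nbhs_singleton fg).
Unshelve. all: by end_near. Qed.

Lemma near_eq_differentiable E W (f g : E -> W) x : (\near x, f x = g x) ->
  differentiable f x -> differentiable g x.
Proof. by move=> fg df; have [] := near_eq_is_diff fg df. Qed.

(** The bound stands for joint continuity.  Keeping the map unbundled lets
    anonymous functions such as composition or scaling be used directly. *)
Definition bounded_bilinear E1 E2 W (b : E1 -> E2 -> W) :=
  [/\ forall x, linear (b x), forall y, linear (b ^~ y)
    & exists C, forall x y, `|b x y| <= C * `|x| * `|y|].

Lemma bounded_bilinear_pack E1 E2 W (b : E1 -> E2 -> W) : bounded_bilinear b ->
  exists2 B : {bilinear E1 -> E2 -> W}, continuous (fun p => B p.1 p.2)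
    & forall x y, B x y = b x y.
Proof.
case=> blr bll [C bC].
have bP : bilinear_for (GRing.Scale.Law.clone _ _ *:%R _)
   (GRing.Scale.Law.clone _ _ *:%R _) b.
  by split=> [y|x]; [exact: bll|exact: blr].
pose bM := bilinear_isBilinear.Build R E1 E2 W _ _ b bP.
pose B : {bilinear E1 -> E2 -> W} := HB.pack b bM.
exists B => //.
(* C may be negative when one of the spaces is trivial. *)
have BC x y : `|B x y| <= `|C| * `|x| * `|y|.
  apply: le_trans (bC x y) _; rewrite ler_wpM2r// ler_wpM2r//.
  exact: ler_norm.
move=> p; apply/subr_cvg0/norm_cvg0P.
pose h (q : E1 * E2) := `|C| * `|q.1 - p.1| * `|q.2|
                        + `|C| * `|p.1| * `|q.2 - p.2|.
have cst0 : cst (0 : R) @ p --> (0 : R) by exact: cvg_cst.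
apply: (squeeze_cvgr _ cst0 (h := h)).
  near=> q; rewrite normr_ge0 /=.
  have -> : B q.1 q.2 - B p.1 p.2 = B (q.1 - p.1) q.2 + B p.1 (q.2 - p.2).
    by rewrite linearBl linearBr addrA subrK.
  exact: (le_trans (ler_normD _ _) (lerD (BC _ _) (BC _ _))).
have -> : (0 : R) = h p by rewrite /h !subrr !normr0 mulr0 mul0r mulr0 addr0.
have c1 : (fun q : E1 * E2 => q.1) @ p --> p.1 by exact: cvg_fst.
have c2 : (fun q : E1 * E2 => q.2) @ p --> p.2 by exact: cvg_snd.
have c1' : (fun q : E1 * E2 => q.1 - p.1) @ p --> p.1 - p.1
  by apply: cvgB => //; exact: cvg_cst.
have c2' : (fun q : E1 * E2 => q.2 - p.2) @ p --> p.2 - p.2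
  by apply: cvgB => //; exact: cvg_cst.
apply: cvgD; apply: cvgM; last exact: cvg_norm c2'.
- by apply: cvgM; [exact: cvg_cst | exact: cvg_norm c1'].
- exact: cvg_norm c2.
- exact: cvg_cst.
Unshelve. all: by end_near. Qed.

Lemma diff_bilinear_comp E E1 E2 W (b : E1 -> E2 -> W) (f : E -> E1)
    (g : E -> E2) x : bounded_bilinear b ->
  differentiable f x -> differentiable g x ->
  differentiable (fun y => b (f y) (g y)) x /\
  forall v, 'd (fun y => b (f y) (g y)) x v =
            b ('d f x v) (g x) + b (f x) ('d g x v).
Proof.
move=> /bounded_bilinear_pack[B Bc Bb] df dg.
have dfg := differentiable_pair df dg.
have dB := @differentiable_bilin R E1 E2 W B (f x, g x) Bc.
have -> : (fun y => b (f y) (g y)) =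
    (fun p : E1 * E2 => B p.1 p.2) \o (fun y => (f y, g y)).
  by apply/funext => y /=; rewrite Bb.
split=> [|v]; first exact: differentiable_comp.
by rewrite diff_comp//= diff_bilin//= diff_pair//= addrC !Bb.
Qed.

Lemma differentiable_bilinear E E1 E2 W (b : E1 -> E2 -> W) (f : E -> E1)
    (g : E -> E2) x : bounded_bilinear b ->
  differentiable f x -> differentiable g x ->
  differentiable (fun y => b (f y) (g y)) x.
Proof. by move=> bb df dg; have [] := diff_bilinear_comp bb df dg. Qed.

Lemma derive_bilinear E E1 E2 W (b : E1 -> E2 -> W) (f : E -> E1)
    (g : E -> E2) x v : bounded_bilinear b ->
  differentiable f x -> differentiable g x ->
  'D_v (fun y => b (f y) (g y)) x = b ('D_v f x) (g x) + b (f x) ('D_v g x).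
Proof.
move=> bb df dg; have [d dE] := diff_bilinear_comp bb df dg.
by rewrite !deriveE.
Qed.

Lemma bounded_bilinear_scale W :
  bounded_bilinear (fun (a : R) (w : W) => a *: w).
Proof.
split=> [a|w|]; [exact: linearP| |by exists 1 => a w; rewrite mul1r normrZ].
by move=> k u v; rewrite scalerDl scalerA.
Qed.

Lemma is_derive_differentiable W (c : R -> W) (t : R) w : is_derive t 1 c w ->
  differentiable c t.
Proof. by move=> [dc _]; exact/derivable1_diffP. Qed.

Lemma is_derive_bilinear E1 E2 W (b : E1 -> E2 -> W) (f : R -> E1)
    (g : R -> E2) (t : R) u v : bounded_bilinear b ->
  is_derive t 1 f u -> is_derive t 1 g v ->
  is_derive t 1 (fun y => b (f y) (g y)) (b u (g t) + b (f t) v).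
Proof.
move=> bb df dg; have := derive_bilinear (1 : R) bb (is_derive_differentiable
  df)
  (is_derive_differentiable dg).
rewrite (derive_val (is_derive := df)) (derive_val (is_derive := dg)) => <-.
apply: derivableP; apply: diff_derivable.
by apply: differentiable_bilinear => //; apply: is_derive_differentiable.
Qed.

Lemma is_derive_diff E W (f : E -> W) (c : R -> E) (t : R) v :
  differentiable f (c t) -> is_derive t 1 c v ->
  is_derive t 1 (fun s => f (c s)) ('d f (c t) v).
Proof.
move=> df dc; have dct := is_derive_differentiable dc.
have dfc : differentiable (f \o c) t by exact: differentiable_comp.
have := deriveE (1 : R) dfc; rewrite diff_comp//= -(deriveE (1 : R) dct)
  derive_val => <-.
by apply: derivableP; apply: diff_derivable.
Qed.

Lemma is_derive_linear E W (L : {linear E -> W}) (c : R -> E) (t : R) v :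
  continuous L -> is_derive t 1 c v -> is_derive t 1 (fun s => L (c s)) (L v).
Proof.
move=> Lc dc; have := is_derive_diff (linear_differentiable (c t) Lc) dc.
by rewrite diff_lin.
Qed.

(** Ck_on mentions the functions 'D_v f outside U as well, but only their
    values on U matter; openness makes the derivatives at points of U depend on
    f restricted to U. *)
Lemma Ck_on_eq E W k (U : set E) (f g : E -> W) : open U ->
  (forall x, U x -> f x = g x) -> Ck_on k U f -> Ck_on k U g.
Proof.
move=> Uo; elim: k f g => [|k IH] f g fg /=.
  move=> fc x Ux; have nfg : \forall y \near x, f y = g y.
    by apply: filterS (open_nbhs_nbhs (conj Uo Ux)).
  have := fc x Ux; rewrite /prop_for /continuous_at -(fg x Ux).
  by apply: cvg_trans; apply: near_eq_cvg.
have nfg x : U x -> \forall y \near x, f y = g y.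
  by move=> Ux; apply: filterS (open_nbhs_nbhs (conj Uo Ux)).
case=> df Df; split=> [x Ux|v].
  exact: near_eq_differentiable (nfg x Ux) (df x Ux).
by apply: IH (Df v) => x Ux; apply: near_eq_derive (nfg x Ux).
Qed.

Lemma Ck_onS E W k (U U' : set E) (f : E -> W) : U `<=` U' ->
  Ck_on k U' f -> Ck_on k U f.
Proof.
move=> UU'; elim: k f => [|k IH] f /=; first by move=> fc x /UU'/fc.
by case=> df Df; split=> [x /UU'/df//|v]; apply: IH.
Qed.

Lemma Ck_onW E W k (U : set E) (f : E -> W) : Ck_on k.+1 U f -> Ck_on k U f.
Proof.
elim: k f => [|k IH] f [df Df].
  by move=> x Ux; apply: differentiable_continuous; apply: df.
by split=> // v; apply: IH.
Qed.

Lemma Ck_on_cst E W k (U : set E) (w : W) : Ck_on k U (fun=> w).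
Proof.
elim: k w => [|k IH] w /=; first by move=> x _; apply: cst_continuous.
split=> // v; have -> : 'D_v (fun=> w) = (fun=> 0) :> (E -> W).
  by apply/funext => x; apply: derive_cst.
exact: IH.
Qed.

Lemma Ck_onD E W k (U : set E) (f g : E -> W) : open U ->
  Ck_on k U f -> Ck_on k U g -> Ck_on k U (fun x => f x + g x).
Proof.
move=> Uo; elim: k f g => [|k IH] f g /=.
  by move=> fc gc x Ux; apply: cvgD; [exact: fc|exact: gc].
case=> df Df [dg Dg]; split=> [x Ux|v].
  by apply: differentiableD; [exact: df|exact: dg].
apply: Ck_on_eq (IH _ _ (Df v) (Dg v)) => // x Ux.
by rewrite [RHS](@deriveD _ _ _ f g)//; apply: diff_derivable;
  [exact: df|exact: dg].
Qed.

Lemma Ck_on_sum E W k (U : set E) (I : Type) (r : seq I) (f : I -> E -> W) :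
  open U -> (forall i, Ck_on k U (f i)) ->
  Ck_on k U (fun x => \sum_(i <- r) f i x).
Proof.
move=> Uo fk; elim: r => [|i r IH].
  by under eq_fun do rewrite big_nil; exact: Ck_on_cst.
by under eq_fun do rewrite big_cons; exact: Ck_onD.
Qed.

Lemma Ck_on_bilinear E E1 E2 W (b : E1 -> E2 -> W) k (U : set E) (f : E -> E1)
    (g : E -> E2) : bounded_bilinear b -> open U ->
  Ck_on k U f -> Ck_on k U g -> Ck_on k U (fun x => b (f x) (g x)).
Proof.
move=> bb Uo; elim: k f g => [|k IH] f g.
  have [B Bc Bb] := bounded_bilinear_pack bb.
  move=> /= fc gc x Ux.
  have -> : (fun y => b (f y) (g y)) =
      (fun p : E1 * E2 => B p.1 p.2) \o (fun y => (f y, g y)).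
    by apply/funext => y /=; rewrite Bb.
  rewrite /prop_for; apply: continuous_comp; last exact: Bc.
  by apply: cvg_pair; [exact: fc|exact: gc].
move=> fk gk; case: (fk) (gk) => df Df [dg Dg]; split=> [x Ux|v].
  by apply: differentiable_bilinear => //; [exact: df|exact: dg].
pose h x := b ('D_v f x) (g x) + b (f x) ('D_v g x).
apply: (@Ck_on_eq _ _ _ _ h) => // [x Ux|].
  by rewrite derive_bilinear//; [exact: df|exact: dg].
apply: Ck_onD => //; first exact: IH (Df v) (Ck_onW gk).
exact: IH (Ck_onW fk) (Dg v).
Qed.

Lemma Ck_on_linear E W W' (L : {linear W -> W'}) k (U : set E) (f : E -> W) :
  continuous L -> open U -> Ck_on k U f -> Ck_on k U (fun x => L (f x)).
Proof.
move=> Lc Uo; elim: k f => [|k IH] f /=.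
  by move=> fc x Ux; apply: continuous_comp; [exact: fc|exact: Lc].
case=> df Df; split=> [x Ux|v].
  apply: differentiable_comp; first exact: df.
  exact: linear_differentiable.
apply: Ck_on_eq (IH _ (Df v)) => // x Ux.
have dL := linear_differentiable (f x) Lc.
have dfx := df x Ux; rewrite (deriveE _ dfx).
rewrite -[RHS]/('D_v (L \o f) x) deriveE; last exact: differentiable_comp.
by rewrite (diff_comp dfx dL) /= diff_lin.
Qed.

Lemma Ck_on_id E k (U : set E) : Ck_on k U (fun x => x).
Proof.
case: k => [|k] /=; first by move=> x _; apply: cvg_id.
split=> [x _|v]; first by have [] := @is_diff_id R E x.
have -> : 'D_v (fun x => x) = (fun=> v) :> (E -> E).
  by apply/funext => x; apply: derive_id.
exact: Ck_on_cst.
Qed.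

End Calculus.
(** * Finite dimensional spaces of linear maps *)

Section Coordinates.
Variables (R : realType) (V : vectType R).
Local Notation b := (vbasis {:V}).

Lemma coord_vbasis_sum (v : V) : v = \sum_(i < \dim {:V}) coord b i v *: b`_i.
Proof. by rewrite -coord_vbasis ?memvf. Qed.

Lemma vec_coordP (u v : V) :
  (forall i : 'I_(\dim {:V}), coord b i u = coord b i v) -> u = v.
Proof.
move=> uv; rewrite [u]coord_vbasis_sum [v]coord_vbasis_sum.
by apply: eq_bigr => i _; rewrite uv.
Qed.

End Coordinates.

Section FiniteDimension.
Variables (R : realType) (aT rT : vectType R).
Implicit Types (f g : 'Hom(aT, rT)) (W : normedModType R).

Local Notation B := (vbasis {:'Hom(aT, rT)}).
Local Notation n := (\dim {:'Hom(aT, rT)}).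

Lemma ler_coord f (i : 'I_n) : `|coord B i f| <= `|f|.
Proof.
rewrite coord_rVof [leRHS]/Num.Def.normr /= /hom_norm.
rewrite [leRHS]/Num.Def.normr /= mx_normrE.
apply: le_trans; last exact: (le_bigmax _ _ (0, i)).
exact: lexx.
Qed.

(** With the norm of coordinates, the norms of the images of the basis vectors
    add up to a Lipschitz constant. *)
Lemma linear_bounded_Hom W (L : {linear 'Hom(aT, rT) -> W}) :
  exists2 C, 0 <= C & forall f, `|L f| <= C * `|f|.
Proof.
exists (\sum_(i < n) `|L B`_i|) => [|f]; first by rewrite sumr_ge0.
rewrite [f in L f]coord_vbasis_sum linear_sum mulr_suml.
apply: le_trans (ler_norm_sum _ _ _) (ler_sum _ _) => i _.
by rewrite linearZ normrZ mulrC ler_wpM2l// ler_coord.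
Qed.

Lemma linear_continuous_Hom W (L : {linear 'Hom(aT, rT) -> W}) : continuous L.
Proof.
have [C C0 LC] := linear_bounded_Hom L.
apply/linear_bounded_continuous/linear_boundedP.
near=> r => f; apply: le_trans (LC f) _; rewrite ler_wpM2r//.
Unshelve. all: by end_near. Qed.

Lemma is_derive_coord (c : R -> 'Hom(aT, rT)) (t : R) w :
  (forall i, is_derive t 1 (fun s => coord B i (c s)) (coord B i w)) ->
  is_derive t 1 c w.
Proof.
move=> dc; have -> : c = \sum_(i < n) (fun s => coord B i (c s) *: B`_i).
  apply/funext => s; rewrite [LHS]coord_vbasis_sum.
  by rewrite (big_morph (fun h : R -> 'Hom(aT, rT) => h s) (id1 := 0) (op1 :=
    +%R)).
rewrite [w]coord_vbasis_sum; apply: is_derive_sum => i.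
have := is_derive_bilinear (bounded_bilinear_scale _) (dc i) (is_derive_cst
  B`_i t 1).
by rewrite scaler0 addr0.
Qed.

(** Uniqueness for the differential equations below: the quantity under study
    is multiplied by a known inverse, and the product has derivative 0. *)
Lemma is_derive_0_cst (c : R -> 'Hom(aT, rT)) :
  (forall t : R, is_derive t 1 c 0) -> forall s t, c s = c t.
Proof.
move=> dc s t; rewrite [LHS]coord_vbasis_sum [RHS]coord_vbasis_sum.
apply: eq_bigr => i _; congr (_ *: _).
apply: (@is_derive_0_is_cst R (fun s => coord B i (c s))) => u.
have [L Lc] := linear_pack (linearP (coord B i)).
have := is_derive_linear (linear_continuous_Hom (L := L)) (dc u).
by rewrite linear0; under eq_fun do rewrite Lc.
Qed.

End FiniteDimension.

Section FiniteDimension2.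
Variables (R : realType) (aT rT aT' rT' : vectType R).

Lemma bounded_bilinear_Hom (W : normedModType R)
    (b : 'Hom(aT, rT) -> 'Hom(aT', rT') -> W) :
  (forall x, linear (b x)) -> (forall y, linear (b ^~ y)) -> bounded_bilinear b.
Proof.
move=> blr bll; split=> //.
pose e i := (vbasis {:'Hom(aT, rT)})`_i;
  pose e' i := (vbasis {:'Hom(aT', rT')})`_i.
exists (\sum_(i < \dim {:'Hom(aT, rT)}) \sum_(j < \dim {:'Hom(aT', rT')})
          `|b (e i) (e' j)|) => x y.
have [L Lb] := linear_pack (bll y);
  rewrite -Lb [x in L x]coord_vbasis_sum linear_sum.
rewrite !mulr_suml; apply: le_trans (ler_norm_sum _ _ _) (ler_sum _ _) => i _.
rewrite linearZ normrZ Lb -/(e i).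
have [L' L'b] := linear_pack (blr (e i));
  rewrite -L'b [y in L' y]coord_vbasis_sum linear_sum.
rewrite !mulr_suml; apply: le_trans (ler_wpM2l (normr_ge0 _) (ler_norm_sum _ _
  _)) _.
rewrite mulr_sumr; apply: ler_sum => j _.
rewrite linearZ normrZ L'b -/(e' j) [leLHS]mulrA [leLHS]mulrC -[leRHS]mulrA.
by rewrite ler_wpM2l// ler_pM ?ler_coord.
Qed.
End FiniteDimension2.
(** * Smoothness of inversion *)

Section Inverse.
Variables (R : realType) (V : vectType R).
Implicit Types (f g h : 'End(V)).

Lemma bounded_bilinear_comp :
  bounded_bilinear (fun f g => (f \o g)%VF : 'End(V)).
Proof.
apply: bounded_bilinear_Hom => [f|g] k u v.
  by rewrite comp_lfunDr -comp_lfunZr.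
by rewrite comp_lfunDl -comp_lfunZl.
Qed.

Lemma ler_norm_comp : exists2 M : R, 0 < M &
  forall f g, `|(f \o g)%VF| <= M * `|f| * `|g|.
Proof.
have [_ _ [C bC]] := bounded_bilinear_comp.
exists (`|C| + 1) => [|f g]; first by rewrite ltr_wpDl.
apply: le_trans (bC f g) _; rewrite ler_wpM2r// ler_wpM2r//.
by rewrite (le_trans (ler_norm _))// lerDl.
Qed.

(** The Neumann estimate.  From g0 o A = (g0 - g) o A + g o A one gets
    |A| <= |A| / 2 + C |g o A| once g is close to g0.  Taking for A the
    projection on the kernel of g shows that g is injective; taking for A the
    inverse of g bounds that inverse. *)
Lemma GL_inv_near g0 : GL g0 ->
  \forall g \near g0, GL g /\ `|(g^-1)%VF| <= 2 * `|(g0^-1)%VF|.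
Proof.
move=> gl0; have [M M0 bM] := ler_norm_comp.
pose K := M * M * `|(g0^-1)%VF|.
have K0 : 0 <= K by rewrite /K !mulr_ge0// ltW.
have e0 : 0 < (2 * (K + 1))^-1 by rewrite invr_gt0 mulr_gt0// ltr_wpDl.
have Kg (B : 'End(V)) g : `|g0 - g| <= (2 * (K + 1))^-1 ->
    `|(g0^-1 \o ((g0 - g) \o B))%VF| <= 2^-1 * `|B|.
  move=> gg0; apply: (le_trans (bM _ _)).
  have h1 : M * `|(g0^-1)%VF| * `|((g0 - g) \o B)%VF| <=
            K * `|g0 - g| * `|B|.
    have -> : K * `|g0 - g| * `|B| =
      M * `|(g0^-1)%VF| * (M * `|g0 - g| * `|B|) by rewrite /K; ring.
    by rewrite ler_wpM2l// mulr_ge0// ltW.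
  apply: (le_trans h1); rewrite ler_wpM2r//.
  have h2 : K * `|g0 - g| <= K * (2 * (K + 1))^-1 by rewrite ler_wpM2l.
  apply: (le_trans h2); rewrite invfM mulrCA -[leRHS]mulr1 ler_wpM2l//.
  by rewrite ler_pdivrMr ?mul1r ?lerDl// ltr_wpDl.
have half (x a : R) : x <= a + 2^-1 * x -> x <= 2 * a by lra.
near=> g; have gg0 : `|g0 - g| <= (2 * (K + 1))^-1.
  by near: g; apply: cvgr_dist_le.
have glg : GL g.
  have pg : (g \o projv (lker g))%VF = 0.
    apply/lfunP => v; rewrite comp_lfunE zero_lfunE.
    by apply/eqP; rewrite -memv_ker memv_proj.
  suff p0 : projv (lker g) = 0.
    by rewrite /GL /= -(limg_proj (lker g)) p0 lim0g eqxx.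
  have := Kg (projv (lker g)) g gg0.
  rewrite comp_lfunDl comp_lfunNl pg subr0 lker0_compKf// => le2.
  apply/eqP; rewrite -normr_le0.
  by have := half _ 0; rewrite mulr0; apply; rewrite add0r.
split=> //; apply: half.
have e : (g^-1)%VF = (g0^-1)%VF + (g0^-1 \o ((g0 - g) \o g^-1))%VF.
  rewrite comp_lfunDl comp_lfunNl comp_lfunDr comp_lfunNr lker0_compKf//.
  by rewrite lker0_compfV// comp_lfun1r addrC subrK.
rewrite {1}e; apply: le_trans (ler_normD _ _) _.
by rewrite lerD2l Kg.
Unshelve. all: by end_near. Qed.

Lemma open_GL : open (@GL R V).
Proof.
by rewrite openE => g gl; apply: filterS (GL_inv_near gl) => ? [].
Qed.

(** The remainder (g + h)^-1 - g^-1 + g^-1 h g^-1 equals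
    g^-1 h g^-1 h (g + h)^-1, which is quadratic in h because (g + h)^-1 stays
    bounded. *)
Lemma is_diff_inv g : GL g ->
  is_diff g (fun f => f^-1)%VF (fun h => - (g^-1 \o (h \o g^-1))%VF).
Proof.
move=> gl; pose i := (g^-1)%VF.
pose D h : 'End(V) := - (i \o (h \o i))%VF.
have Dlin : linear D.
  move=> a u v; rewrite /D comp_lfunDl comp_lfunDr opprD -comp_lfunZl.
  by rewrite -comp_lfunZr scalerN.
have [L LE] := linear_pack Dlin; rewrite -/i -/D;
  have <- : L = D :> (_ -> _) by exact/funext.
apply: is_diff_near => [|eps eps0]; first exact: linear_continuous_Hom.
have [M M0 bM] := ler_norm_comp.
pose K := M ^+ 4 * `|i| ^+ 3 * 2.
have K0 : 0 <= K by rewrite /K !(mulr_ge0, exprn_ge0, normr_ge0, ltW M0).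
near=> h.
have [glh ih] : GL (h + g) /\ `|((h + g)^-1)%VF| <= 2 * `|i|.
  near: h; have := GL_inv_near gl; rewrite (near_shift 0) /= subr0.
  exact.
have -> : ((h + g)^-1)%VF - (g^-1)%VF - L h =
    (i \o (h \o (i \o (h \o (h + g)^-1))))%VF.
  have e : (i \o (h \o (h + g)^-1))%VF = i - ((h + g)^-1)%VF.
    transitivity (i \o (((h + g) - g) \o (h + g)^-1))%VF;
      first by rewrite addrK.
    rewrite comp_lfunDl comp_lfunNl lker0_compfV//.
    by rewrite comp_lfunDr comp_lfun1r comp_lfunNr lker0_compKf.
  rewrite e comp_lfunDr comp_lfunNr comp_lfunDr comp_lfunNr e -/i LE /D.
  by rewrite opprK opprB addrC.
have h1 : `|h| * K <= eps.
  near: h.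
  have ek0 : 0 < eps / (K + 1) by rewrite divr_gt0// ltr_wpDl.
  have /cvgrPdist_le/(_ _ ek0) : id @ (0 : 'End(V)) --> (0 : 'End(V)).
    exact: cvg_id.
  apply: filterS => h; rewrite sub0r normrN => hK.
  apply: le_trans (ler_wpM2r K0 hK) _; rewrite -mulrA ger_pMr//.
  by rewrite mulrC ler_pdivrMr ?mul1r ?lerDl// ltr_wpDl.
have w (b : R) f1 f2 : 0 <= b -> `|f2| <= b ->
    `|(f1 \o f2)%VF| <= M * `|f1| * b.
  move=> b0 le; apply: le_trans (bM _ _) _; rewrite ler_wpM2l//.
  by rewrite mulr_ge0// ltW.
have M0' := ltW M0.
have h2 : `|(i \o (h \o (i \o (h \o (h + g)^-1))))%VF| <=
  M * `|i| * (M * `|h| * (M * `|i| * (M * `|h| * (2 * `|i|)))).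
  by do 4!(apply: (w _ _ _); first by do !apply: mulr_ge0).
apply: (le_trans h2).
have -> : M * `|i| * (M * `|h| * (M * `|i| * (M * `|h| * (2 * `|i|)))) =
    `|h| * K * `|h|.
  by rewrite /K; ring.
by rewrite ler_wpM2r.
Unshelve. all: by end_near. Qed.

(** The derivative of inversion is bilinear in inversion itself, so its
    regularity bootstraps. *)
Lemma Ck_on_inv k : Ck_on k (@GL R V) (fun f : 'End(V) => f^-1)%VF.
Proof.
elim: k => [|k IH].
  move=> g gl; apply: differentiable_continuous.
  by have [] := is_diff_inv gl.
split=> [g gl|v]; first by have [] := is_diff_inv gl.
pose h g : 'End(V) := ((g^-1 \o ((- v) \o g^-1)))%VF.
apply: (@Ck_on_eq _ _ _ _ _ h); first exact: open_GL.
  move=> g gl; have [d dE] := is_diff_inv gl.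
  by rewrite deriveE// dE /h comp_lfunNl comp_lfunNr.
apply: (Ck_on_bilinear bounded_bilinear_comp) => //; first exact: open_GL.
apply: (Ck_on_bilinear bounded_bilinear_comp) => //; first exact: open_GL.
exact: Ck_on_cst.
Qed.

End Inverse.
(** * The exponential of an endomorphism *)

Section Egf.
Variable R : realType.
Implicit Type u : nat -> R.

Definition geometric_bound u := exists C M, forall k, `|u k| <= C * M ^+ k.

(** Working with the coordinates of the exponential reduces its construction
    to scalar power series: the exponential generating function of u, whose
    derivative is that of the shifted sequence. *)
Definition egf u (t : R) : R := limn (pseries (fun k => u k / k`!%:R) t).

Lemma geometric_boundS u :
  geometric_bound u -> geometric_bound (fun k => u k.+1).
Proof.
move=> [C [M uC]]; exists (C * M), M => k.
by rewrite -mulrA -exprS.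
Qed.

Lemma egf_cvg u (t : R) : geometric_bound u ->
  cvgn (pseries (fun k => u k / k`!%:R) t).
Proof.
move=> [C [M uC]]; apply: normed_cvg.
pose v k := C *: exp_coeff (M * `|t|) k.
have uv n : `|u n / n`!%:R * t ^+ n| <= v n.
  rewrite !normrM normrX normfV normr_nat /v /exp_coeff /=.
  have d0 : 0 <= (n`!%:R : R)^-1 by rewrite invr_ge0 ler0n.
  rewrite -[leRHS]/(C * _); set d := _^-1 in d0 *.
  have -> : C * ((M * `|t|) ^+ n * d) = C * M ^+ n * d * `|t| ^+ n.
    by rewrite exprMn; ring.
  by rewrite ler_wpM2r ?exprn_ge0// ler_wpM2r.
apply: (@series_le_cvg _ _ v) => [n|n|n|]; rewrite /=.
- exact: normr_ge0.
- exact: le_trans (normr_ge0 _) (uv n).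
- exact: uv.
- exact: is_cvg_seriesZ (is_cvg_series_exp_coeff _).
Qed.

Lemma is_derive_egf u (t : R) : geometric_bound u ->
  is_derive t 1 (egf u) (egf (fun k => u k.+1) t).
Proof.
move=> bu; have d v : pseries_diffs (fun k => v k / k`!%:R) =
    (fun k => v k.+1 / k`!%:R) :> (nat -> R).
  apply/funext => k; rewrite /pseries_diffs factS natrM invfM mulrCA.
  by rewrite mulVKf// pnatr_eq0.
have buS := geometric_boundS bu; have buSS := geometric_boundS buS.
rewrite /egf -d; apply: (@pseries_snd_diffs _ _ (`|t| + 1)).
- exact: egf_cvg.
- by rewrite d; exact: egf_cvg.
- by rewrite d d; exact: egf_cvg.
- by rewrite [ltRHS]ger0_norm ?addr_ge0// ltrDl.
Qed.

Lemma egf0 u : egf u 0 = u 0.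
Proof.
apply/cvg_lim => //; apply: cvg_near_cst; exists 1%N => // n /= n0.
rewrite /pseries /series /= -(prednK n0) big_nat_recl//= expr0 mulr1 divr1.
by rewrite big1 ?addr0// => k _; rewrite expr0n mulr0.
Qed.

Lemma egf_sum n (a : 'I_n -> R) (u : 'I_n -> nat -> R) t :
  (forall i, geometric_bound (u i)) ->
  egf (fun k => \sum_i a i * u i k) t = \sum_i a i * egf (u i) t.
Proof.
move=> bu; apply/cvg_lim => //.
have -> : pseries (fun k => (\sum_i a i * u i k) / k`!%:R) t =
    (fun m => \sum_i a i * pseries (fun k => u i k / k`!%:R) t m).
  apply/funext => m; rewrite /pseries /series /=.
  under [RHS]eq_bigr do rewrite mulr_sumr.
  rewrite exchange_big /=; apply: eq_bigr => k _.
  by rewrite !mulr_suml; apply: eq_bigr => i _; rewrite !mulrA.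
elim: (index_enum _) => [|i r IH].
  by under eq_fun do rewrite big_nil; rewrite big_nil; exact: cvg_cst.
under eq_fun do rewrite big_cons; rewrite big_cons; apply: cvgD => //.
by apply: cvgM; [exact: cvg_cst | exact: egf_cvg].
Qed.

End Egf.
Section Exponential.
Variables (R : realType) (V : vectType R).
Implicit Types (p : nat -> 'End(V)) (H : 'End(V)).

Local Notation B := (vbasis {:'End(V)}).
Local Notation n := (\dim {:'End(V)}).

Definition lfun_egf p (t : R) : 'End(V) :=
  \sum_(i < n) egf (fun k => coord B i (p k)) t *: B`_i.

Lemma coord_lfun_egf p t (i : 'I_n) :
  coord B i (lfun_egf p t) = egf (fun k => coord B i (p k)) t.
Proof. by rewrite /lfun_egf coord_sum_free// (basis_free (vbasisP _)). Qed.

Lemma lfun_egf0 p : lfun_egf p 0 = p 0%N.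
Proof.
rewrite [RHS]coord_vbasis_sum; apply: eq_bigr => i _; congr (_ *: _).
exact: egf0.
Qed.

Lemma geometric_bound_coord p (i : 'I_n) :
  (exists C M, forall k, `|p k| <= C * M ^+ k) ->
  geometric_bound (fun k => coord B i (p k)).
Proof.
move=> [C [M pC]]; exists C, M => k.
exact: le_trans (ler_coord _ _) (pC k).
Qed.

(** A linear map commutes with the coordinatewise construction; with left and
    right composition by H this gives both differential equations of the
    exponential. *)
Lemma lfun_egf_linear (L : {linear 'End(V) -> 'End(V)}) p t :
  (exists C M, forall k, `|p k| <= C * M ^+ k) ->
  L (lfun_egf p t) = lfun_egf (fun k => L (p k)) t.
Proof.
move=> pb; rewrite [LHS]coord_vbasis_sum; apply: eq_bigr => i _.
congr (_ *: _); rewrite [in LHS]/lfun_egf linear_sum.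
have cL (f : 'End(V)) : coord B i (L f) =
    \sum_(j < n) coord B i (L B`_j) * coord B j f.
  rewrite [f in LHS]coord_vbasis_sum linear_sum linear_sum.
  by apply: eq_bigr => j _; rewrite linearZ linearZ /= mulrC.
under [in RHS]eq_fun do rewrite cL.
rewrite egf_sum => [|j]; last exact: geometric_bound_coord.
by rewrite linear_sum; apply: eq_bigr => j _; rewrite linearZ linearZ /= mulrC.
Qed.

Lemma is_derive_lfun_egf p (t : R) :
  (exists C M, forall k, `|p k| <= C * M ^+ k) ->
  is_derive t 1 (lfun_egf p) (lfun_egf (fun k => p k.+1) t).
Proof.
move=> pb; apply: is_derive_coord => i.
under eq_fun do rewrite coord_lfun_egf; rewrite coord_lfun_egf.
exact: (is_derive_egf t (geometric_bound_coord i pb)).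
Qed.

Definition lfun_exp H := lfun_egf (fun k => iter k (comp_lfun H) \1%VF).

Lemma lfun_exp_bound H : exists C M : R, forall k,
  `|iter k (comp_lfun H) \1%VF| <= C * M ^+ k.
Proof.
have [M M0 bM] := @ler_norm_comp R V.
exists `|\1%VF : 'End(V)|, (M * `|H|); elim=> [|k IH]; first by rewrite mulr1.
rewrite iterS; apply: (le_trans (bM _ _)); rewrite exprS mulrCA ler_wpM2l//.
by rewrite mulr_ge0// ltW.
Qed.

Lemma lfun_exp0 H : lfun_exp H 0 = \1%VF.
Proof. exact: lfun_egf0. Qed.

Lemma is_derive_lfun_expl H (t : R) :
  is_derive t 1 (lfun_exp H) (H \o lfun_exp H t)%VF.
Proof.
have b := lfun_exp_bound H; have := is_derive_lfun_egf t b.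
have [lH _ _] := @bounded_bilinear_comp R V.
have [L LE] := linear_pack (lH H); rewrite -LE lfun_egf_linear//.
suff -> : (fun k => iter k.+1 (comp_lfun H) \1%VF) =
          (fun k => L (iter k (comp_lfun H) \1%VF)) by [].
by apply/funext => k; rewrite LE.
Qed.

Lemma is_derive_lfun_expr H (t : R) :
  is_derive t 1 (lfun_exp H) (lfun_exp H t \o H)%VF.
Proof.
have b := lfun_exp_bound H; have := is_derive_lfun_egf t b.
have [_ lH _] := @bounded_bilinear_comp R V.
have [L LE] := linear_pack (lH H); rewrite -LE lfun_egf_linear//.
suff -> : (fun k => iter k.+1 (comp_lfun H) \1%VF) =
          (fun k => L (iter k (comp_lfun H) \1%VF)) by [].
apply/funext; elim=> [|k IH]; rewrite LE.
  by rewrite /= comp_lfun1l comp_lfun1r.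
by rewrite !iterS -comp_lfunA -LE -IH.
Qed.

(** Constant in t: the two terms of the derivative are - E(-H) H E(H) and
    E(-H) H E(H). *)
Lemma lfun_expNK H (t : R) : (lfun_exp (- H) t \o lfun_exp H t)%VF = \1%VF.
Proof.
pose c s := (lfun_exp (- H) s \o lfun_exp H s)%VF.
rewrite -[LHS]/(c t); transitivity (c 0).
  2: by rewrite /c !lfun_exp0 comp_lfun1l.
apply: is_derive_0_cst => s.
have := is_derive_bilinear (@bounded_bilinear_comp R V)
  (is_derive_lfun_expr (- H) s) (is_derive_lfun_expl H s).
by rewrite comp_lfunNr comp_lfunNl comp_lfunA addNr.
Qed.

Lemma lfun_expKN H (t : R) : (lfun_exp H t \o lfun_exp (- H) t)%VF = \1%VF.
Proof. by rewrite -[H in lfun_exp H]opprK lfun_expNK. Qed.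

Lemma GL_lfun_exp H t : GL (lfun_exp H t).
Proof.
apply/lker0P => x y /(congr1 (lfun_exp (- H) t)).
by rewrite -!comp_lfunE lfun_expNK !id_lfunE.
Qed.

End Exponential.
(** * Trace and Euclidean frames *)

Section Trace.
Variables (R : realType) (V : vectType R).
Implicit Types (f g : 'End(V)).

Local Notation b := (vbasis {:V}).

Lemma lfun_trace_linear : linear (@lfun_trace R V).
Proof.
move=> a f g; rewrite /lfun_trace.
under eq_bigr do rewrite add_lfunE scale_lfunE linearP.
by rewrite big_split; congr (_ + _); rewrite -[RHS]/(a * _) mulr_sumr.
Qed.

Lemma lfun_traceD f g : lfun_trace (f + g) = lfun_trace f + lfun_trace g.
Proof. by have := lfun_trace_linear 1 f g; rewrite !scale1r. Qed.

Lemma lfun_traceZ a f : lfun_trace (a *: f) = a * lfun_trace f.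
Proof.
have z : lfun_trace (0 : 'End(V)) = 0.
  by rewrite /lfun_trace big1// => i _; rewrite zero_lfunE linear0.
by have := lfun_trace_linear a f 0; rewrite addr0 z addr0.
Qed.

Lemma lfun_traceN f : lfun_trace (- f) = - lfun_trace f.
Proof. by rewrite -scaleN1r lfun_traceZ mulN1r. Qed.

Lemma lfun_traceC f g : lfun_trace (f \o g)%VF = lfun_trace (g \o f)%VF.
Proof.
have tE f' g' : lfun_trace (f' \o g')%VF = \sum_(i < \dim {:V})
    \sum_(j < \dim {:V}) coord b j (g' b`_i) * coord b i (f' b`_j).
  apply: eq_bigr => i _; rewrite comp_lfunE.
  rewrite [g' _ in LHS]coord_vbasis_sum !linear_sum.
  by apply: eq_bigr => j _; rewrite !linearZ.
rewrite !tE exchange_big; apply: eq_bigr => i _; apply: eq_bigr => j _.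
by rewrite mulrC.
Qed.

Section Frame.
Variable form : V -> V -> R.
Hypothesis form_linear : forall v (a : R) x y,
  form (a *: x + y) v = a * form x v + form y v.
Hypothesis formC : forall x y, form x y = form y x.
Hypothesis form_gt0 : forall x, x != 0 -> 0 < form x x.

Let formD x y v : form (x + y) v = form x v + form y v.
Proof. by have := form_linear v 1 x y; rewrite scale1r mul1r. Qed.

Let form0 v : form 0 v = 0.
Proof. by apply: (addrI (form 0 v)); rewrite -formD !addr0. Qed.

Let formZ a x v : form (a *: x) v = a * form x v.
Proof. by have := form_linear v a x 0; rewrite form0 !addr0. Qed.

(** Orthonormalization without orthonormality: only the expansion of vectors is
    used later.  Split off a unit vector u of U; the vectors of U orthogonal to
    u form a space of smaller dimension. *)
Lemma exists_frame_vspace (U : {vspace V}) : exists2 s : seq V,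
  {subset s <= U} & forall v, v \in U -> v = \sum_(w <- s) form v w *: w.
Proof.
have [n] := ubnP (\dim U); elim: n U => // n IH U.
have [->|U0] := eqVneq U 0%VS.
  by move=> _; exists [::] => // v; rewrite memv0 big_nil => /eqP.
rewrite ltnS => Un.
have [u uU uu] : exists2 u, u \in U & form u u = 1.
  have p0 : 0 < form (vpick U) (vpick U) by rewrite form_gt0// vpick0.
  exists ((Num.sqrt (form (vpick U) (vpick U)))^-1 *: vpick U).
    by rewrite memvZ// memv_pick.
  rewrite formZ formC formZ mulrA -invfM -expr2 sqr_sqrtr ?ltW//.
  by rewrite mulVf// gt_eqF.
pose P v := v - form v u *: u.
have Plin : linear P.
  move=> a x y; rewrite /P form_linear scalerDl opprD scalerBr scalerA.
  by rewrite addrACA.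
have [Q QE] := linear_pack Plin.
pose W := (U :&: lker (linfun Q - \1%VF))%VS.
(* W is the orthogonal of u in U: Q v = v means that v is orthogonal to u. *)
have WP v : (v \in W) = (v \in U) && (form v u == 0).
  rewrite memv_cap memv_ker add_lfunE opp_lfunE lfunE id_lfunE /= QE /P.
  rewrite addrAC subrr add0r oppr_eq0 scaler_eq0 orbC; congr (_ && _).
  by case: eqP => //= u_0; move: uu; rewrite u_0 form0 => /eqP;
    rewrite eq_sym oner_eq0.
have uW : u \notin W by rewrite WP uu oner_eq0 andbF.
have WU : (W <= U)%VS by rewrite capvSl.
have WltU : (\dim W < n)%N.
  rewrite (leq_trans _ Un)// ltn_neqAle dimvS// andbT (dimv_leqif_sup WU).
  by apply: contra uW => /subvP; apply.
have [s sW sE] := IH W WltU.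
exists (u :: s) => [w|v vU].
  by rewrite inE => /predU1P[->//|/sW]; rewrite WP => /andP[].
have PW : P v \in W.
  rewrite WP /P memvB ?memvZ//= formD -scaleNr formZ uu mulr1 subrr eqxx//.
rewrite big_cons; have := sE _ PW; rewrite {1}/P => /eqP.
rewrite subr_eq addrC => /eqP {1}->; congr (_ + _).
apply: eq_big_seq => w /sW; rewrite WP => /andP[_ /eqP wu].
by congr (_ *: _); rewrite /P formD -scaleNr formZ [form u w]formC wu mulr0
  addr0.
Qed.

Lemma exists_frame : exists s : seq V,
  forall v, v = \sum_(w <- s) form v w *: w.
Proof.
by have [s _ sE] := exists_frame_vspace fullv; exists s => v;
  rewrite -sE ?memvf.
Qed.

Lemma lfun_trace_frame (s : seq V) f :
  (forall v, v = \sum_(w <- s) form v w *: w) ->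
  lfun_trace f = \sum_(w <- s) form (f w) w.
Proof.
move=> sE; rewrite /lfun_trace.
have fE i : coord b i (f b`_i) =
    \sum_(w <- s) form (coord b i (f w) *: b`_i) w.
  rewrite [X in f X]sE !linear_sum; apply: eq_bigr => w _.
  by rewrite !linearZ /= formZ mulrC.
under eq_bigr do rewrite fE.
rewrite exchange_big; apply: eq_bigr => w _.
rewrite {2}[f w]coord_vbasis_sum.
by rewrite (big_morph (form^~ w) (fun x y => formD x y w) (form0 w)).
Qed.

(** In a frame, Tr(f g) is the sum of the squared lengths of the g w when g is
    the adjoint of f. *)
Lemma lfun_trace_adjoint f g :
  (forall x y, form (f x) y = form x (g y)) ->
  0 <= lfun_trace (f \o g)%VF /\ (lfun_trace (f \o g)%VF = 0 -> g = 0).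
Proof.
move=> fg; have [s sE] := exists_frame.
have form_ge0 x : 0 <= form x x.
  by have [->|/form_gt0/ltW//] := eqVneq x 0; rewrite form0.
rewrite (lfun_trace_frame _ sE).
have -> : \sum_(w <- s) form ((f \o g)%VF w) w = \sum_(w <- s) form (g w) (g w).
  by apply: eq_bigr => w _; rewrite comp_lfunE fg.
split=> [|/eqP]; first by apply: sumr_ge0.
rewrite psumr_eq0// => /allP g0; apply/lfunP => v; rewrite zero_lfunE.
rewrite [v]sE linear_sum big1_seq// => w /andP[_ ws]; rewrite linearZ /=.
suff -> : g w = 0 by rewrite scaler0.
apply/eqP; apply: contraT => /form_gt0; rewrite lt_neqAle => /andP[].
by rewrite eq_sym (implyP (g0 w ws)).
Qed.

End Frame.
End Trace.

(** * Linear identities between endomorphisms *)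

Section LfunRing.
Variables (R : realType) (V : vectType R).
Implicit Types (f g h : 'End(V)).

Lemma lfun_coordP f g :
  (forall (i : 'I_(\dim {:V})) w,
     coord (vbasis {:V}) i (f w) = coord (vbasis {:V}) i (g w)) -> f = g.
Proof. by move=> fg; apply/lfunP => w; apply: vec_coordP => i. Qed.

Lemma lfun_coordE (i : 'I_(\dim {:V})) w :
  (forall f g, coord (vbasis {:V}) i ((f + g) w) =
     coord (vbasis {:V}) i (f w) + coord (vbasis {:V}) i (g w)) *
  (forall f, coord (vbasis {:V}) i ((- f) w) = - coord (vbasis {:V}) i (f w)) *
  (forall k f, coord (vbasis {:V}) i ((k *: f) w) =
     k * coord (vbasis {:V}) i (f w)) *
  (coord (vbasis {:V}) i ((0 : 'End(V)) w) = 0).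
Proof.
by do !split; move=> *; rewrite ?(add_lfunE, opp_lfunE, scale_lfunE, zero_lfunE)
  ?(linearD, linearN, linearZ, linear0).
Qed.

Lemma comp_lfun_expand :
  (forall f g h, ((f + g) \o h)%VF = (f \o h)%VF + (g \o h)%VF) *
  (forall f g h, (h \o (f + g))%VF = (h \o f)%VF + (h \o g)%VF) *
  (forall f h, ((- f) \o h)%VF = - (f \o h)%VF) *
  (forall f h, (h \o (- f))%VF = - (h \o f)%VF) *
  (forall (k : R) f h, ((k *: f) \o h)%VF = k *: (f \o h)%VF) *
  (forall (k : R) f h, (h \o (k *: f))%VF = k *: (h \o f)%VF).
Proof.
by do !split; move=> *; rewrite ?(comp_lfunDl, comp_lfunDr, comp_lfunNl,
  comp_lfunNr) -?comp_lfunZl -?comp_lfunZr.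
Qed.

End LfunRing.

(* Endomorphisms of V do not form a ring for the ring tactic (V may be zero, and
   composition is not commutative).  After composition is distributed over sums,
   an identity that is linear in the remaining composites can be checked on each
   coordinate of the image of an arbitrary vector. *)
Ltac lfun_ring :=
  let i := fresh "i" in let w := fresh "w" in
  apply: lfun_coordP => i w; rewrite ?comp_lfun_expand ?comp_lfunA !lfun_coordE;
  by [ring | field].

(** * Euclidean Jordan algebras *)

Section Jordan.
Variables (R : realType) (V : vectType R) (jmul : V -> V -> V) (e : V).
Hypothesis VJ : euclidean_jordan_algebra jmul e.
Implicit Types (x y z w a b c : V) (D H K : 'End(V)).

Local Notation "x ** y" := (jmul x y) (at level 40, left associativity).
Local Notation L := (jL jmul).

Let jC x y : x ** y = y ** x. Proof. by case: VJ. Qed.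
Let je x : x ** e = x. Proof. by case: VJ. Qed.
Let jJ x y : (x ** x) ** (x ** y) = x ** ((x ** x) ** y).
Proof. by case: VJ. Qed.
Let jlin x (k : R) y z : x ** (k *: y + z) = k *: (x ** y) + x ** z.
Proof. by case: VJ => lin _ _ _ _; exact: lin. Qed.
Let jDr x y z : x ** (y + z) = x ** y + x ** z.
Proof. by have := jlin x 1 y z; rewrite !scale1r. Qed.
Let j0r x : x ** 0 = 0.
Proof. by apply: (addrI (x ** 0)); rewrite -jDr !addr0. Qed.
Let jZr k x y : x ** (k *: y) = k *: (x ** y).
Proof. by have := jlin x k y 0; rewrite j0r !addr0. Qed.
Let jNr x y : x ** (- y) = - (x ** y).
Proof. by rewrite -scaleN1r jZr scaleN1r. Qed.
Let jDl x y z : (y + z) ** x = y ** x + z ** x.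
Proof. by rewrite !(jC _ x) jDr. Qed.
Let jZl k x y : (k *: y) ** x = k *: (y ** x).
Proof. by rewrite !(jC _ x) jZr. Qed.
Let jNl x y : (- y) ** x = - (y ** x).
Proof. by rewrite !(jC _ x) jNr. Qed.
Let jE := (jDl, jDr, jZl, jZr, jNl, jNr).

Let coordD (i : 'I_(\dim {:V})) :
  (forall u v, coord (vbasis {:V}) i (u + v) =
     coord (vbasis {:V}) i u + coord (vbasis {:V}) i v) *
  (forall u, coord (vbasis {:V}) i (- u) = - coord (vbasis {:V}) i u) *
  (forall k u, coord (vbasis {:V}) i (k *: u) = k * coord (vbasis {:V}) i u).
Proof. by split; [split=> *; rewrite ?linearD ?linearN|move=> *;
  rewrite linearZ]. Qed.

(** The terms of degree 2 in z of the Jordan identity at x + z: add the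
    identities at x + z and at x - z. *)
Lemma jordan_polarized2 x z y :
  (z ** z) ** (x ** y) + 2 *: ((x ** z) ** (z ** y)) =
  x ** ((z ** z) ** y) + 2 *: (z ** ((x ** z) ** y)).
Proof.
have h0 := jJ z y.
have h1 := jJ x y.
have h2 := jJ (x + z) y.
have h3 := jJ (x + - z) y.
move: h0 h1 h2 h3; rewrite !jE !opprK !(jC z x).
move=> h0 h1 h2 h3; apply: vec_coordP => i.
move: (congr1 (coord (vbasis {:V}) i) h0) (congr1 (coord (vbasis {:V}) i) h1)
 (congr1 (coord (vbasis {:V}) i) h2) (congr1 (coord (vbasis {:V}) i) h3).
rewrite !coordD; lra.
Qed.

(** As operators on y, [L_(zw), L_x] + [L_(wx), L_z] + [L_(xz), L_w] = 0. *)
Lemma jordan_polarized x z w y :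
  (x ** z) ** (w ** y) + (z ** w) ** (x ** y) + (w ** x) ** (z ** y) =
  x ** ((z ** w) ** y) + z ** ((w ** x) ** y) + w ** ((x ** z) ** y).
Proof.
have h0 := jordan_polarized2 x z y.
have h1 := jordan_polarized2 x w y.
have h2 := jordan_polarized2 x (z + w) y.
move: h0 h1 h2; rewrite !jE !scalerDr !(jC w z) !(jC w x).
move=> h0 h1 h2; apply: vec_coordP => i.
move: (congr1 (coord (vbasis {:V}) i) h0) (congr1 (coord (vbasis {:V}) i) h1)
 (congr1 (coord (vbasis {:V}) i) h2).
rewrite !coordD; lra.
Qed.

Definition lfun_lie (f g : 'End(V)) : 'End(V) := (f \o g)%VF - (g \o f)%VF.

Lemma lfun_lieE (f g : 'End(V)) w : lfun_lie f g w = f (g w) - g (f w).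
Proof. by rewrite add_lfunE opp_lfunE !comp_lfunE. Qed.

Lemma jL_linear : linear L.
Proof.
move=> k x y; apply/lfunP => w.
by rewrite add_lfunE scale_lfunE !(jLE VJ) jDl jZl.
Qed.

Lemma jLD x y : L (x + y) = L x + L y.
Proof. by have := jL_linear 1 x y; rewrite !scale1r. Qed.

Lemma jL0 : L 0 = 0.
Proof. by apply: (addrI (L 0)); rewrite -jLD !addr0. Qed.

Lemma jLN x : L (- x) = - L x.
Proof. by apply: (addrI (L x)); rewrite -jLD !subrr jL0. Qed.

Lemma jLZ k x : L (k *: x) = k *: L x.
Proof. by have := jL_linear k x 0; rewrite jL0 !addr0. Qed.

(** The polarized identity is symmetric in its four arguments on the left but
    not on the right, where the last one plays a distinguished role.
    Exchanging the roles of x and y and subtracting leaves the derivation rule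
    for [L_x, L_y]; the rest of the proof normalizes commutative products. *)
Lemma Der_lie_jL x y : Der jmul (lfun_lie (L x) (L y)).
Proof.
move=> z w; rewrite !lfun_lieE !(jLE VJ).
have h0 := jordan_polarized x z w y.
have h1 := jordan_polarized y z w x.
move: h0 h1; rewrite !jE.
rewrite !(jC z y) !(jC z x) !(jC y x) !(jC w x) !(jC w y).
rewrite (jC (z ** w) y) (jC (z ** w) x) (jC (x ** w) y) (jC (y ** w) x).
rewrite (jC w (x ** z ** y)) (jC w (y ** z ** x)) (jC (x ** z) y) (jC (y ** z)
  x).
rewrite (jC (x ** w)) (jC (y ** w)).
move=> h0 h1; apply: vec_coordP => i.
move: (congr1 (coord (vbasis {:V}) i) h0) (congr1 (coord (vbasis {:V}) i) h1).
rewrite !coordD; lra.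
Qed.

Lemma Der_linear (k : R) D K : Der jmul D -> Der jmul K -> Der jmul (k *: D +
  K).
Proof.
move=> dD dK x y; rewrite !add_lfunE !scale_lfunE dD dK !jE scalerDr.
by rewrite addrACA.
Qed.

Lemma Der_unit D : Der jmul D -> D e = 0.
Proof.
move=> dD; have := dD e e; rewrite je (jC e) je => h.
by apply: (addrI (D e)); rewrite addr0 -h.
Qed.

Lemma Der_lie D K : Der jmul D -> Der jmul K -> Der jmul (lfun_lie D K).
Proof.
move=> dD dK x y; rewrite !lfun_lieE; do !rewrite ?dD ?dK ?linearD ?jE /=.
apply: vec_coordP => i; rewrite !coordD; lra.
Qed.

Lemma lie_Der_jL D x : Der jmul D -> lfun_lie D (L x) = L (D x).
Proof.
move=> dD; apply/lfunP => w; rewrite lfun_lieE !(jLE VJ) dD.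
by rewrite addrK.
Qed.

Lemma dagger_linear : linear (dagger jmul e).
Proof.
move=> k H K; rewrite /dagger add_lfunE scale_lfunE jL_linear.
by apply/lfunP => w; apply: vec_coordP => i;
  rewrite !(add_lfunE, opp_lfunE, scale_lfunE) !coordD; ring.
Qed.

Lemma str_linear (k : R) H K : str jmul H -> str jmul K -> str jmul (k *: H +
  K).
Proof.
move=> [x [D dD ->]] [y [D' dD' ->]]; exists (k *: x + y).
exists (k *: D + D'); first exact: Der_linear.
by rewrite jL_linear scalerDr addrACA.
Qed.

Lemma Der0 : Der jmul 0.
Proof. by move=> x y; rewrite !zero_lfunE (jC 0) !j0r addr0. Qed.

Lemma str0 : str jmul 0.
Proof. by exists 0; exists 0; rewrite ?jL0 ?addr0//; exact: Der0. Qed.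

Lemma strD H K : str jmul H -> str jmul K -> str jmul (H + K).
Proof. by move=> sH sK; rewrite -(scale1r H); exact: str_linear. Qed.

Lemma strZ (k : R) H : str jmul H -> str jmul (k *: H).
Proof. by move=> sH; rewrite -(addr0 (_ *: _)); apply: str_linear => //;
  exact: str0. Qed.

Lemma strN H : str jmul H -> str jmul (- H).
Proof. by move=> sH; rewrite -scaleN1r; exact: strZ. Qed.

Lemma str_dagger H : str jmul H -> str jmul (dagger jmul e H).
Proof.
move=> [x [D dD ->]]; rewrite (dagger_LD VJ)//; exists x.
exists (- D) => //; rewrite -(addr0 (- D)) -scaleN1r.
by apply: Der_linear => //; exact: Der0.
Qed.

Lemma str_lie H K : str jmul H -> str jmul K -> str jmul (lfun_lie H K).
Proof.
move=> [x [D dD ->]] [y [D' dD' ->]].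
exists (D y - D' x); exists (1 *: lfun_lie (L x) (L y) + lfun_lie D D').
  by apply: Der_linear; [exact: Der_lie_jL|exact: Der_lie].
rewrite jLD jLN -!lie_Der_jL// scale1r.
apply/lfunP => w; rewrite !(add_lfunE, opp_lfunE, lfun_lieE) !linearD.
by apply: vec_coordP => i; rewrite !coordD; ring.
Qed.

(** If H = L_x + D then x = H e, so H lies in str exactly when H - L_(He) obeys
    the product rule; the defect is linear in H. *)
Definition str_defect y z H : V :=
  (H - L (H e)) (y ** z) - ((H - L (H e)) y ** z + y ** (H - L (H e)) z).

Lemma str_defect_linear y z : linear (str_defect y z).
Proof.
move=> k H K; have He : (k *: H + K) e = k *: H e + K e.
  by rewrite add_lfunE scale_lfunE.
rewrite /str_defect He jL_linear.
rewrite !(add_lfunE, opp_lfunE, scale_lfunE) !jE.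
by apply: vec_coordP => i; rewrite !coordD; ring.
Qed.

(** Linear equations for str, which pass to derivatives of paths. *)
Lemma strP H : str jmul H <-> forall y z, str_defect y z H = 0.
Proof.
split=> [[x [D dD ->]] y z|h].
  have He : (L x + D) e = x by rewrite add_lfunE (jLE VJ) je (Der_unit dD)
    addr0.
  by rewrite /str_defect He (addrC (L x)) addrK dD subrr.
exists (H e); exists (H - L (H e)); last by rewrite addrC subrK.
by move=> y z; apply/eqP; rewrite -subr_eq0; apply/eqP; exact: h.
Qed.

(** The polarization of the quadratic representation U. *)
Definition jU2 x y : 'End(V) := (L x \o L y)%VF + (L y \o L x)%VF - L (x ** y).

Lemma jUE x w : jU jmul x w = 2 *: (x ** (x ** w)) - (x ** x) ** w.
Proof.
by rewrite /jU add_lfunE scale_lfunE opp_lfunE comp_lfunE !(jLE VJ).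
Qed.

(** The derivative at t = 0 of U_(g y) = g U_y g^* along g = exp(tH).  For a
    derivation it is the product rule; for L_x it combines the two polarized
    Jordan identities. *)
Lemma str_jU H y : str jmul H ->
  2 *: jU2 (H y) y = (H \o jU jmul y)%VF + (jU jmul y \o dagger jmul e H)%VF.
Proof.
move=> [x [D dD ->]]; rewrite (dagger_LD VJ)//; apply/lfunP => w.
rewrite !(add_lfunE, opp_lfunE, scale_lfunE, comp_lfunE, jUE, jLE VJ).
have h0 := jordan_polarized2 x y w.
have h1 := jordan_polarized x y w y.
have jUD : D (2 *: (y ** (y ** w)) - (y ** y) ** w) =
    2 *: (y ** (D y ** w) + D y ** (y ** w) + y ** (y ** D w)) -
    (2 *: ((D y ** y) ** w) + (y ** y) ** D w).
  rewrite linearB linearZ /= !dD !jE (jC y (D y)).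
  by apply: vec_coordP => i; rewrite !coordD; lra.
rewrite jUD !jE.
move: h0 h1; rewrite !(jC w y) !(jC w x) (jC (y ** w) y) (jC (x ** w) y).
rewrite (jC (y ** w) (x ** y)) (jC (x ** w) (y ** y)) (jC w).
move=> h0 h1; apply: vec_coordP => i.
move: (congr1 (coord (vbasis {:V}) i) h0) (congr1 (coord (vbasis {:V}) i) h1).
rewrite !coordD; lra.
Qed.

Lemma jtr_linear : linear (jtr jmul).
Proof. by move=> k x y; rewrite /jtr jL_linear lfun_trace_linear. Qed.

Lemma jtr_Der D x : Der jmul D -> jtr jmul (D x) = 0.
Proof.
move=> dD; rewrite /jtr -lie_Der_jL// lfun_traceD lfun_traceN.
by rewrite lfun_traceC subrr.
Qed.

Lemma jtrD x y : jtr jmul (x + y) = jtr jmul x + jtr jmul y.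
Proof. by have := jtr_linear 1 x y; rewrite !scale1r. Qed.

Lemma jtrN x : jtr jmul (- x) = - jtr jmul x.
Proof.
have t0 : jtr jmul 0 = 0 by apply: (addrI (jtr jmul 0)); rewrite -jtrD !addr0.
by apply: (addrI (jtr jmul x)); rewrite -jtrD !subrr.
Qed.

(** (x y) z - x (y z) = [L_z, L_x] y, and jtr kills the image of a derivation.
  *)
Lemma jtrA x y z : jtr jmul ((x ** y) ** z) = jtr jmul (x ** (y ** z)).
Proof.
have := jtr_Der y (Der_lie_jL z x); rewrite lfun_lieE !(jLE VJ).
rewrite (jC z y) (jC z) => h.
by rewrite -[(x ** y) ** z](subrK (x ** (y ** z))) jtrD h add0r.
Qed.

Lemma jtr_Der_skew D x y : Der jmul D ->
  jtr jmul (D x ** y) = - jtr jmul (x ** D y).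
Proof.
move=> dD; have := jtr_Der (x ** y) dD; rewrite dD jtrD => /eqP.
by rewrite addr_eq0 => /eqP.
Qed.

Lemma lfun_trace_str_gt0 x D : Der jmul D -> L x + D != 0 ->
  0 < lfun_trace (L x \o L x)%VF - lfun_trace (D \o D)%VF.
Proof.
move=> dD H0; pose form x y := jtr jmul (x ** y).
have form_lin v (a : R) x' y : form (a *: x' + y) v = a * form x' v + form y v.
  by rewrite /form jDl jZl jtr_linear.
have formC x' y : form x' y = form y x' by rewrite /form jC.
have form_gt0 x' : x' != 0 -> 0 < form x' x' by case: VJ => _ _ _ _; apply.
have adjL u v : form (L x u) v = form u (L x v).
  by rewrite /form !(jLE VJ) (jC x u) jtrA.
have adjD u v : form (D u) v = form u ((- D) v).
  by rewrite /form opp_lfunE jNr jtr_Der_skew// jtrN.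
have [L0 Lz] := lfun_trace_adjoint form_lin formC form_gt0 adjL.
have [D0 Dz] := lfun_trace_adjoint form_lin formC form_gt0 adjD.
move: D0 Dz; rewrite comp_lfunNr lfun_traceN => D0 Dz.
rewrite lt0r addr_ge0// andbT; apply: contra H0 => /eqP h.
have t1 : lfun_trace (L x \o L x)%VF = 0 by lra.
have t2 : - lfun_trace (D \o D)%VF = 0 by lra.
by rewrite (Lz t1) -[D]opprK (Dz t2) oppr0 addr0.
Qed.

End Jordan.
(** * Functions on a subset with enough curves *)

Section SmoothOnSubset.
Variables (R : realType) (E : normedModType R) (M : set E).
Implicit Types W : normedModType R.

Lemma smooth_bilinear (E1 E2 : normedModType R) W (b : E1 -> E2 -> W) (f : M ->
  E1) (g : M -> E2) :
  bounded_bilinear b -> smooth f -> smooth g -> smooth (fun p => b (f p) (g p)).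
Proof.
move=> bb sf sg p; have [U [F [Uo Up FU fF]]] := sf p.
have [U' [G [U'o U'p GU' gG]]] := sg p.
exists (U `&` U'), (fun x => b (F x) (G x)); split=> //.
- exact: openI.
- move=> k; apply: Ck_on_bilinear => //; first exact: openI.
    by apply: Ck_onS (FU k) => ? [].
  by apply: Ck_onS (GU' k) => ? [].
- by move=> q [Uq U'q]; rewrite fF// gG.
Qed.

Lemma smoothD W (f g : M -> W) :
  smooth f -> smooth g -> smooth (fun p => f p + g p).
Proof.
move=> sf sg p; have [U [F [Uo Up FU fF]]] := sf p.
have [U' [G [U'o U'p GU' gG]]] := sg p.
exists (U `&` U'), (fun x => F x + G x); split=> //.
- exact: openI.
- move=> k; apply: Ck_onD => //; first exact: openI.
    by apply: Ck_onS (FU k) => ? [].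
  by apply: Ck_onS (GU' k) => ? [].
- by move=> q [Uq U'q]; rewrite fF// gG.
Qed.

Lemma smooth_linear (W W' : normedModType R) (L : {linear W -> W'}) (f : M ->
  W) : continuous L ->
  smooth f -> smooth (fun p => L (f p)).
Proof.
move=> Lc sf p; have [U [F [Uo Up FU fF]]] := sf p.
exists U, (fun x => L (F x)); split=> //; last by move=> q Uq; rewrite fF.
by move=> k; apply: Ck_on_linear.
Qed.

Lemma smooth_val : smooth (fun p : M => val p).
Proof.
move=> p; exists setT, id; split=> //; first exact: openT.
by move=> k; exact: Ck_on_id.
Qed.

Section Tderive.
Variable T : M -> set E.
Hypothesis exists_curve : forall p v, T p v ->
  exists2 c : R -> M, c 0 = p & is_derive (0 : R) 1 (fun t => val (c t)) v.

(** One curve with velocity v suffices to determine the derivative. *)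
Lemma tderive_eq W (f : M -> W) p v w : T p v ->
  (forall c : R -> M, c 0 = p -> is_derive (0 : R) 1 (fun t => val (c t)) v ->
     is_derive (0 : R) 1 (fun t => f (c t)) w) ->
  tderive f p v = w.
Proof.
move=> Tv fw; have [c c0 dc] := exists_curve Tv.
apply: xget_unique => // w' fw'.
have d1 := fw c c0 dc; have d2 := fw' c c0 dc.
by rewrite -(derive_val (is_derive := d1)) -(derive_val (is_derive := d2)).
Qed.

(** Continuity keeps the curve in U near 0, where f is the extension F. *)
Lemma extension_derive W (f : M -> W) (U : set E) (F : E -> W) (p : M) v c :
  open U -> U (val p) -> differentiable F (val p) ->
  (forall q : M, U (val q) -> f q = F (val q)) ->
  c 0 = p -> is_derive (0 : R) 1 (fun t => val (c t)) v ->
  is_derive (0 : R) 1 (fun t => f (c t)) ('d F (val p) v).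
Proof.
move=> Uo Up dF fF c0 dc.
have dct : {for (0 : R), continuous (fun t => val (c t))}.
  exact/differentiable_continuous/(is_derive_differentiable dc).
apply: (@near_eq_is_derive _ _ _ (fun t => F (val (c t)))).
  have : \forall t \near (0 : R), U (val (c t)).
    by apply: dct; apply: open_nbhs_nbhs; split=> //; rewrite c0.
  by apply: filterS => t Ut; rewrite fF.
by rewrite -c0; apply: (is_derive_diff (c := fun t => val (c t))); rewrite ?c0.
Qed.

Lemma tderive_extension W (f : M -> W) (U : set E) (F : E -> W) (p : M) v :
  open U -> U (val p) -> differentiable F (val p) ->
  (forall q : M, U (val q) -> f q = F (val q)) ->
  T p v -> tderive f p v = 'd F (val p) v.
Proof.
move=> Uo Up dF fF Tv; apply: tderive_eq => // c c0 dc.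
exact: (extension_derive Uo Up dF fF c0 dc).
Qed.

Lemma tderiveP W (f : M -> W) p v c : smooth f -> T p v -> c 0 = p ->
  is_derive (0 : R) 1 (fun t => val (c t)) v ->
  is_derive (0 : R) 1 (fun t => f (c t)) (tderive f p v).
Proof.
move=> sf Tv c0 dc; have [U [F [Uo Up FU fF]]] := sf p.
have dF : differentiable F (val p) by have [df _] := FU 1%N; exact: df.
by rewrite (tderive_extension Uo Up dF fF Tv);
  exact: extension_derive dF fF c0 dc.
Qed.

Lemma tderive_linear W (f : M -> W) p (a : R) u v : smooth f ->
  T p u -> T p v -> T p (a *: u + v) ->
  tderive f p (a *: u + v) = a *: tderive f p u + tderive f p v.
Proof.
move=> sf Tu Tv Tuv; have [U [F [Uo Up FU fF]]] := sf p.
have dF : differentiable F (val p) by have [df _] := FU 1%N; exact: df.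
by rewrite !(tderive_extension Uo Up dF fF)// linearP.
Qed.

End Tderive.

End SmoothOnSubset.

Section SmoothTderive.
Variables (R : realType) (aT rT : vectType R).
Variables (M : set 'Hom(aT, rT)) (T : M -> set 'Hom(aT, rT)).
Hypothesis exists_curve : forall p v, T p v ->
  exists2 c : R -> M, c 0 = p & is_derive (0 : R) 1 (fun t => val (c t)) v.

Local Notation B := (vbasis {:'Hom(aT, rT)}).
Local Notation n := (\dim {:'Hom(aT, rT)}).

(** Near p the derivative is sum_i X_i D_(e_i) f for extensions of f and X, by
    linearity of the differential. *)
Lemma smooth_tderive (W : normedModType R) (f : M -> W) (X : M -> 'Hom(aT, rT))
  :
  smooth f -> vector_field T X -> smooth (fun p => tderive f p (X p)).
Proof.
move=> sf [sX TX] p; have [U [F [Uo Up FU fF]]] := sf p.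
have [U' [G [U'o U'p GU' gG]]] := sX p.
pose H x := \sum_(i < n) coord B i (G x) *: 'D_(B`_i) F x.
have Io := openI Uo U'o.
exists (U `&` U'), H; split=> //.
  move=> k; apply: Ck_on_sum => // i.
  apply: (Ck_on_bilinear (@bounded_bilinear_scale R W)) => //.
    have [L Lc] := linear_pack (linearP (coord B i));
      under eq_fun do rewrite -Lc.
    apply: Ck_on_linear => //; first exact: linear_continuous_Hom.
    by apply: Ck_onS (GU' k) => ? [].
  by have [_ DF] := FU k.+1; apply: Ck_onS (DF _) => ? [].
move=> q [Uq U'q].
have dF : differentiable F (val q) by have [df _] := FU 1%N; exact: df.
rewrite (tderive_extension exists_curve Uo Uq dF fF (TX q)) gG//.
rewrite [X in 'd F _ X]coord_vbasis_sum linear_sum; apply: eq_bigr => i _.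
by rewrite linearZ deriveE.
Qed.

End SmoothTderive.
(** * The structure group *)

Section StructureGroup.
Variables (R : realType) (V : vectType R) (jmul : V -> V -> V) (e : V).
Hypothesis VJ : euclidean_jordan_algebra jmul e.
Implicit Types (f h A B H K : 'End(V)) (g p : Str jmul).

Local Notation L := (jL jmul).
Local Notation dag := (dagger jmul e).
Local Notation T := (@tangent_Str R V jmul).

Lemma jU2C (x y : V) : jU2 jmul x y = jU2 jmul y x.
Proof.
case: (VJ) => _ jC _ _ _; rewrite /jU2 (jC x y).
by congr (_ - _); rewrite addrC.
Qed.

Lemma jU_jU2 (x : V) : jU jmul x = jU2 jmul x x.
Proof. by rewrite /jU /jU2 scaler_nat mulr2n. Qed.

Lemma jU2_linear (x : V) : linear (jU2 jmul x).
Proof.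
case: (VJ) => jlin jC _ _ _.
by move=> k y z; rewrite /jU2 jlin !(jL_linear VJ); lfun_ring.
Qed.

Lemma bounded_bilinear_jU2 (y : V) :
  bounded_bilinear (fun f h => jU2 jmul (f y) (h y)).
Proof.
apply: bounded_bilinear_Hom => [f|h] k u v; rewrite !add_lfunE !scale_lfunE.
  by rewrite jU2_linear.
by rewrite jU2C jU2_linear ![jU2 _ (h y) _]jU2C.
Qed.

(** exp(-tH) U_(exp(tH) y) exp(-t H^dag) is constant in t by str_jU. *)
Lemma jU_lfun_exp H (y : V) (t : R) : str jmul H ->
  jU jmul (lfun_exp H t y) =
  (lfun_exp H t \o (jU jmul y \o lfun_exp (dag H) t))%VF.
Proof.
move=> sH; pose E := lfun_exp H; pose F := lfun_exp (- dag H).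
pose U s := jU2 jmul (E s y) (E s y).
pose c s := (lfun_exp (- H) s \o (U s \o F s))%VF.
have ct : c t = c 0.
  apply: is_derive_0_cst => s.
  have dU : is_derive s (1 : R) U ((H \o U s)%VF + (U s \o dag H)%VF).
    rewrite /U -[in X in is_derive _ _ _ X]jU_jU2 -(str_jU VJ _ sH).
    have dE := is_derive_lfun_expl H s.
    have := is_derive_bilinear (bounded_bilinear_jU2 y) dE dE.
    rewrite !comp_lfunE -/E [X in _ + X]jU2C.
    by rewrite scaler_nat mulr2n.
  have d1 := is_derive_bilinear (@bounded_bilinear_comp R V) dU
    (is_derive_lfun_expl (- dag H) s).
  have d2 := is_derive_bilinear (@bounded_bilinear_comp R V)
    (is_derive_lfun_expr (- H) s) d1.
  rewrite /c; apply: (is_derive_eq d2).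
  by lfun_ring.
have c0 : c 0 = jU jmul y.
  rewrite /c /F /U /E !lfun_exp0 id_lfunE comp_lfun1l comp_lfun1r.
  by rewrite jU_jU2.
rewrite -c0 -ct /c !comp_lfunA lfun_expKN comp_lfun1l -!comp_lfunA.
by rewrite lfun_expNK comp_lfun1r jU_jU2.
Qed.

Lemma Str_lfun_exp H (t : R) : str jmul H -> Str jmul (lfun_exp H t).
Proof.
move=> sH; split; first exact: GL_lfun_exp.
by exists (lfun_exp (dag H) t) => [|x]; [exact: GL_lfun_exp|exact: jU_lfun_exp].
Qed.

Lemma GL_comp f h : GL f -> GL h -> GL (f \o h)%VF.
Proof.
move=> /lker0P If /lker0P Ih; apply/lker0P => x y.
by rewrite !comp_lfunE => /If/Ih.
Qed.

Lemma Str_comp f h : Str jmul f -> Str jmul h -> Str jmul (f \o h)%VF.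
Proof.
move=> [Gf [fs Gfs fU]] [Gh [hs Ghs hU]]; split; first exact: GL_comp.
exists (hs \o fs)%VF => [|x]; first exact: GL_comp.
by rewrite comp_lfunE fU hU !comp_lfunA.
Qed.

Lemma StrP g : Str jmul (val g).
Proof. by case: g => g /= /set_mem. Qed.

Lemma GL_Str g : GL (val g).
Proof. by case: (StrP g). Qed.

Lemma Str_compVK g A : ((val g)^-1 \o (val g \o A))%VF = A.
Proof. by apply: lker0_compKf; exact: GL_Str. Qed.

Lemma Str_compKV g A : (val g \o ((val g)^-1 \o A))%VF = A.
Proof. by apply: lker0_compVKf; exact: GL_Str. Qed.

Lemma exists_curve_Str g A : T g A -> exists2 c : R -> Str jmul, c 0 = g &
  is_derive (0 : R) 1 (fun t => val (c t)) A.
Proof.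
move=> [H sH ->].
have cP t : (val g \o lfun_exp H t)%VF \in Str jmul.
  by apply/mem_set; apply: Str_comp; [exact: StrP|exact: Str_lfun_exp].
exists (fun t => exist (fun f => f \in Str jmul) _ (cP t)).
  by apply: val_inj; rewrite /= lfun_exp0 comp_lfun1r.
have := is_derive_bilinear (@bounded_bilinear_comp R V)
  (is_derive_cst (val g) (0 : R) 1) (is_derive_lfun_expl H 0).
by rewrite comp_lfun0l add0r lfun_exp0 comp_lfun1r.
Qed.

Lemma is_derive_str (c : R -> 'End(V)) (w : 'End(V)) :
  (forall t, str jmul (c t)) -> is_derive (0 : R) 1 c w -> str jmul w.
Proof.
move=> sc dc; apply/(strP VJ) => y z; apply: vec_coordP => i; rewrite linear0.
pose F f : R := coord (vbasis {:V}) i (str_defect jmul e y z f).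
have lF : linear F.
  by move=> k u v; rewrite /F (str_defect_linear VJ) linearP.
have [l lE] := linear_pack lF.
have := is_derive_linear (linear_continuous_Hom (L := l)) dc.
rewrite lE /F.
have -> : (fun s => l (c s)) = (fun=> 0).
  by apply/funext => s; rewrite lE /F (strP VJ (c s)).1 ?linear0.
by case=> _; rewrite derive_cst.
Qed.

(** The metric read at the identity by left translation. *)
Definition str_form H K : R :=
  2^-1 * lfun_trace ((H \o dag K) + (K \o dag H))%VF.

Lemma str_formC H K : str_form H K = str_form K H.
Proof. by rewrite /str_form addrC. Qed.

Lemma str_form_linear K : linear (str_form ^~ K).
Proof.
move=> k H H'; rewrite /str_form (dagger_linear VJ).
move: (dag H) (dag H') (dag K) => dH dH' dK.
rewrite !comp_lfun_expand !(lfun_traceD, lfun_traceZ) -[k *: _]/(k * _); ring.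
Qed.

Lemma str_formDl H H' K : str_form (H + H') K = str_form H K + str_form H' K.
Proof. by have := str_form_linear K 1 H H'; rewrite !scale1r. Qed.

Lemma str_formDr H K K' : str_form H (K + K') = str_form H K + str_form H K'.
Proof. by rewrite ![str_form H _]str_formC str_formDl. Qed.

Lemma bounded_bilinear_str_form :
  bounded_bilinear (str_form : 'End(V) -> 'End(V) -> R).
Proof.
apply: bounded_bilinear_Hom => [f|h]; last exact: str_form_linear.
by move=> k u v; rewrite ![str_form f _]str_formC str_form_linear.
Qed.

Lemma str_form_LD (x y : V) (D D' : 'End(V)) : Der jmul D -> Der jmul D' ->
  str_form (L x + D) (L y + D') =
  lfun_trace (L x \o L y)%VF - lfun_trace (D \o D')%VF.
Proof.
move=> dD dD'; rewrite /str_form !(dagger_LD VJ)//.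
rewrite !(comp_lfunDl, comp_lfunDr) !(comp_lfunNl, comp_lfunNr).
rewrite !(lfun_traceD, lfun_traceN).
rewrite [lfun_trace (L y \o L x)%VF]lfun_traceC.
rewrite [lfun_trace (L y \o D)%VF]lfun_traceC.
rewrite [lfun_trace (D' \o L x)%VF]lfun_traceC.
rewrite [lfun_trace (D' \o D)%VF]lfun_traceC.
lra.
Qed.

Lemma str_form_gt0 H : str jmul H -> H != 0 -> 0 < str_form H H.
Proof.
move=> [x [D dD ->]] H0; rewrite str_form_LD//.
exact: (lfun_trace_str_gt0 VJ).
Qed.

Lemma metric_StrE g A B :
  metric_Str e g A B = str_form ((val g)^-1 \o A)%VF ((val g)^-1 \o B)%VF.
Proof. by []. Qed.

(** The polarized spray read at the identity by left translation. *)
Definition str_gamma H K : 'End(V) := 2^-1 *: ((H \o K)%VF + (K \o H)%VF +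
  (dag H \o K)%VF + (dag K \o H)%VF - (H \o dag K)%VF - (K \o dag H)%VF).

Lemma str_gammaC H K : str_gamma H K = str_gamma K H.
Proof.
rewrite /str_gamma; congr (_ *: _); rewrite addrAC; congr (_ - _ - _).
by rewrite [(K \o H)%VF + _]addrC addrAC.
Qed.

Lemma str_gamma_linear H : linear (str_gamma H).
Proof.
move=> k K K'; rewrite /str_gamma (dagger_linear VJ).
by move: (dag H) (dag K) (dag K') => dH dK dK'; lfun_ring.
Qed.

Lemma polarization_gamma g A B :
  polarization (@spray_Str R V jmul e) g A B =
  (val g \o str_gamma ((val g)^-1 \o A) ((val g)^-1 \o B))%VF.
Proof.
rewrite -{1}(Str_compKV g A) -{1}(Str_compKV g B).
by rewrite (polarization_spray_Str VJ) /str_gamma -comp_lfunZr.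
Qed.

(** The algebraic part of nabla: the term H K comes from differentiating
    g o K(g) in its first factor. *)
Definition str_skew H K : 'End(V) := (H \o K)%VF - str_gamma H K.

(** This form shows membership in str, being made of brackets. *)
Lemma str_skewE H K : str_skew H K =
  2^-1 *: (lfun_lie H K - lfun_lie (dag H) K - lfun_lie (dag K) H).
Proof.
rewrite /str_skew /str_gamma /lfun_lie.
by move: (dag H) (dag K) => dH dK; lfun_ring.
Qed.

Lemma str_str_skew H K : str jmul H -> str jmul K -> str jmul (str_skew H K).
Proof.
move=> sH sK; rewrite str_skewE; apply: (strZ VJ); apply: (strD VJ).
  apply: (strD VJ); first exact: (str_lie VJ).
  by apply: (strN VJ); apply: (str_lie VJ) => //; exact: (str_dagger VJ).
by apply: (strN VJ); apply: (str_lie VJ) => //; exact: (str_dagger VJ).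
Qed.

Lemma lfun_trace_lie (f1 f2 f3 : 'End(V)) :
  lfun_trace (lfun_lie f1 f2 \o f3)%VF = lfun_trace (f1 \o lfun_lie f2 f3)%VF.
Proof.
rewrite /lfun_lie comp_lfunDl comp_lfunDr comp_lfunNl comp_lfunNr.
rewrite !lfun_traceD !lfun_traceN -comp_lfunA; congr (_ - _).
by rewrite -comp_lfunA lfun_traceC comp_lfunA.
Qed.

(** The L and Der components of str_skew H K are z and F below.  In the pairing
    with K = L_y + D' the terms Tr([D, L_y] L_y) and Tr([D, D'] D') vanish, and
    Tr([D', L_x] L_y) = Tr([L_x, L_y] D') cancels the last one. *)
Lemma str_form_skew_diag H K : str jmul H -> str jmul K ->
  str_form (str_skew H K) K = 0.
Proof.
move=> [x [D dD ->]] [y [D' dD' ->]].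
pose z := 3 * 2^-1 *: D y + 2^-1 *: D' x.
pose F := 2^-1 *: lfun_lie (L x) (L y) + 2^-1 *: lfun_lie D D'.
have -> : str_skew (L x + D) (L y + D') = L z + F.
  rewrite str_skewE !(dagger_LD VJ)// /z (jL_linear VJ) (jLZ VJ).
  rewrite -!(lie_Der_jL VJ)// /F.
  by rewrite /lfun_lie; lfun_ring.
have dF : Der jmul F.
  apply: (Der_linear VJ); first exact: (Der_lie_jL VJ).
  rewrite -(addr0 (_ *: _)); apply: (Der_linear VJ); first exact: (Der_lie VJ).
  exact: (Der0 VJ).
rewrite str_form_LD// /z (jL_linear VJ) (jLZ VJ) -!(lie_Der_jL VJ)// /F.
have TrE (a c : R) f1 f2 f3 : lfun_trace ((a *: f1 + c *: f2) \o f3)%VF =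
    a * lfun_trace (f1 \o f3)%VF + c * lfun_trace (f2 \o f3)%VF.
  by rewrite !comp_lfun_expand !(lfun_traceD, lfun_traceZ).
rewrite !TrE !lfun_trace_lie.
have lie0 f : lfun_lie f f = 0 by rewrite /lfun_lie subrr.
have Tr0 : lfun_trace (0 : 'End(V)) = 0.
  by rewrite -(scale0r 0) lfun_traceZ mul0r.
rewrite !lie0 !comp_lfun0r Tr0 mulr0 add0r mulr0 addr0.
by rewrite lfun_traceC lfun_trace_lie subrr.
Qed.

End StructureGroup.
(** * The Levi-Civita connection *)

Section LeviCivita.
Variables (R : realType) (V : vectType R) (jmul : V -> V -> V) (e : V).
Hypothesis VJ : euclidean_jordan_algebra jmul e.
Implicit Types (A B H K : 'End(V)) (g p : Str jmul).

Local Notation dag := (dagger jmul e).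
Local Notation T := (@tangent_Str R V jmul).
Local Notation form := (str_form jmul e).
Local Notation gamma := (str_gamma jmul e).
Local Notation skew := (str_skew jmul e).
Local Notation nabla := (spray_connection (@spray_Str R V jmul e)).

Lemma bounded_bilinear_gamma : bounded_bilinear (gamma : 'End(V) -> 'End(V) ->
  'End(V)).
Proof.
apply: bounded_bilinear_Hom => [H|K]; first exact: str_gamma_linear.
by move=> k H H'; rewrite ![gamma _ K]str_gammaC (str_gamma_linear VJ).
Qed.

Lemma str_skew_linear H : linear (skew H).
Proof.
move=> k K K'; rewrite /str_skew (str_gamma_linear VJ).
by move: (gamma H K) (gamma H K') => G G'; lfun_ring.
Qed.

(** Polarization of str_form_skew_diag in K. *)
Lemma str_form_skew H K K' : str jmul H -> str jmul K -> str jmul K' ->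
  form (skew H K) K' + form K (skew H K') = 0.
Proof.
move=> sH sK sK'; have d := str_form_skew_diag VJ sH.
have skD : skew H (K + K') = skew H K + skew H K'.
  by have := str_skew_linear H 1 K K'; rewrite !scale1r.
have := d _ (strD VJ sK sK'); rewrite skD (str_formDr VJ _ K K').
rewrite !(str_formDl VJ (skew H K) (skew H K')) !d// add0r addr0.
by rewrite [form (skew H K') _]str_formC addrC.
Qed.

Lemma tangent_linear p (a : R) A B : T p A -> T p B -> T p (a *: A + B).
Proof.
move=> [H sH ->] [K sK ->]; exists (a *: H + K); first exact: (str_linear VJ).
by rewrite comp_lfunDr -comp_lfunZr.
Qed.

Lemma tangent_str p A : T p A -> str jmul ((val p)^-1 \o A)%VF.
Proof. by move=> [H sH ->]; rewrite Str_compVK. Qed.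

Lemma smooth_Str_inv : smooth (fun p : Str jmul => (val p)^-1)%VF.
Proof.
move=> p; exists (@GL R V), (fun f => f^-1)%VF; split=> //.
- exact: open_GL.
- exact: GL_Str.
- by move=> k; exact: Ck_on_inv.
Qed.

Lemma smooth_left X : smooth X -> smooth (fun p => (val p)^-1 \o X p :
  'End(V))%VF.
Proof.
move=> sX; apply: (smooth_bilinear (@bounded_bilinear_comp R V)) => //.
exact: smooth_Str_inv.
Qed.

Lemma is_derive_left (Y : Str jmul -> 'End(V)) p A (c : R -> Str jmul) :
  smooth Y -> T p A -> c 0 = p -> is_derive (0 : R) 1 (fun t => val (c t)) A ->
  is_derive (0 : R) 1 (fun t => (val (c t))^-1 \o Y (c t))%VF
    (((val p)^-1 \o tderive Y p A)%VF -
     (((val p)^-1 \o A) \o ((val p)^-1 \o Y p))%VF).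
Proof.
move=> sY TA c0 dc.
have dY := tderiveP (exists_curve_Str VJ) sY TA c0 dc.
have [dI dIE] := is_diff_inv (GL_Str p).
have dI0 : differentiable (fun f : 'End(V) => f^-1)%VF (val (c 0)) by rewrite
  c0.
have := is_derive_diff dI0 dc; rewrite c0 dIE => dV.
have := is_derive_bilinear (@bounded_bilinear_comp R V) dV dY; rewrite c0.
by rewrite comp_lfunNl -!comp_lfunA addrC.
Qed.

(** The derivative of p^-1 o Y(p) in the direction A. *)
Definition left_derive (Y : Str jmul -> 'End(V)) p A : 'End(V) :=
  ((val p)^-1 \o tderive Y p A)%VF - (((val p)^-1 \o A) \o ((val p)^-1 \o Y
    p))%VF.

Lemma str_left_derive Y p A : vector_field T Y -> T p A ->
  str jmul (left_derive Y p A).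
Proof.
move=> [sY TY] TA; have [c c0 dc] := exists_curve_Str VJ TA.
apply: (is_derive_str VJ _ (is_derive_left sY TA c0 dc)) => t.
exact/tangent_str/TY.
Qed.

Lemma nablaE X Y p : nabla X Y p =
  (val p \o (left_derive Y p (X p) +
             skew ((val p)^-1 \o X p)%VF ((val p)^-1 \o Y p)%VF))%VF.
Proof.
rewrite /spray_connection (polarization_gamma VJ) /left_derive /str_skew.
by rewrite addrA subrK comp_lfunDr comp_lfunNr Str_compKV.
Qed.

Lemma nabla_vector_field X Y :
  vector_field T X -> vector_field T Y -> vector_field T (nabla X Y).
Proof.
move=> vX vY; have [[sX TX] [sY TY]] := (vX, vY); split; last first.
  move=> p; rewrite nablaE; eexists; last by [].
  apply: (strD VJ); first exact: str_left_derive.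
  by apply: (str_str_skew VJ); exact: tangent_str.
have -> : nabla X Y = fun p => tderive Y p (X p) +
    - (val p \o gamma ((val p)^-1 \o X p)%VF ((val p)^-1 \o Y p)%VF)%VF.
  by apply/funext => p; rewrite /spray_connection (polarization_gamma VJ).
apply: smoothD; first exact: (smooth_tderive (@exists_curve_Str R V jmul e VJ)
  sY vX).
apply: (smooth_linear (L := GRing.opp)); first exact: linear_continuous_Hom.
apply: (smooth_bilinear (@bounded_bilinear_comp R V)); first exact: smooth_val.
by apply: (smooth_bilinear bounded_bilinear_gamma); exact: smooth_left.
Qed.

Lemma polarization_linear p (a : R) A A' B :
  polarization (@spray_Str R V jmul e) p (a *: A + A') B =
  a *: polarization (@spray_Str R V jmul e) p A B +
  polarization (@spray_Str R V jmul e) p A' B.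
Proof.
have [_ gl _] := bounded_bilinear_gamma.
have gD H H' K : gamma (a *: H + H') K = a *: gamma H K + gamma H' K.
  exact: gl.
have cD f A1 A2 : (f \o (a *: A1 + A2))%VF = a *: (f \o A1)%VF + (f \o A2)%VF.
  by rewrite comp_lfunDr -comp_lfunZr.
by rewrite !(polarization_gamma VJ) cD gD cD.
Qed.

Lemma polarizationC p A B : polarization (@spray_Str R V jmul e) p A B =
  polarization (@spray_Str R V jmul e) p B A.
Proof. by rewrite /polarization [A + B]addrC addrAC. Qed.

Lemma affine_connection_nabla : affine_connection T nabla.
Proof.
have cv := @exists_curve_Str R V jmul e VJ.
split.
- exact: nabla_vector_field.
- move=> f X X' Y sf [sX TX] [sX' TX'] [sY TY] p.
  rewrite /spray_connection polarization_linear (tderive_linear cv)//.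
    by rewrite scalerBr opprD addrACA.
  exact: tangent_linear.
- move=> X Y Y' [sX TX] [sY TY] [sY' TY'] p.
  rewrite /spray_connection ![polarization _ p (X p) _]polarizationC.
  have := polarization_linear p 1 (Y p) (Y' p) (X p); rewrite !scale1r => ->.
  rewrite opprD addrACA; congr (_ + _); apply: (tderive_eq cv) => // c c0 dc.
  by apply: is_deriveD; exact: (tderiveP cv).
- move=> f X Y sf [sX TX] [sY TY] p.
  rewrite /spray_connection ![polarization _ p (X p) _]polarizationC.
  have P0 : polarization (@spray_Str R V jmul e) p 0 (X p) = 0.
    have := polarization_linear p 1 0 0 (X p).
    by rewrite !scale1r addr0 -[LHS]addr0 => /addrI.
  have := polarization_linear p (f p) (Y p) 0 (X p); rewrite P0 !addr0 => ->.
  rewrite scalerBr addrA; congr (_ - _); apply: (tderive_eq cv) => // c c0 dc.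
  have := is_derive_bilinear (@bounded_bilinear_scale R _)
    (tderiveP cv sf (TX p) c0 dc) (tderiveP cv sY (TX p) c0 dc).
  by rewrite c0.
Qed.

Lemma torsion_free_nabla : torsion_free T nabla.
Proof.
move=> X Y vX vY p; rewrite /spray_connection /lie_bracket opprB addrA.
by rewrite polarizationC subrK.
Qed.

Lemma metric_compatible_nabla :
  metric_compatible T (@metric_Str R V jmul e) nabla.
Proof.
have cv := @exists_curve_Str R V jmul e VJ.
move=> X Y Z vX vY vZ p; have [[sX TX] [sY TY] [sZ TZ]] := And3 vX vY vZ.
rewrite !metric_StrE !nablaE !Str_compVK.
rewrite (str_formDl VJ (left_derive Y p (X p))).
rewrite (str_formDr VJ _ (left_derive Z p (X p))).
rewrite addrACA (str_form_skew (tangent_str (TX p)) (tangent_str (TY p))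
  (tangent_str (TZ p))) addr0; apply: (tderive_eq cv) => // c c0 dc.
have := is_derive_bilinear (bounded_bilinear_str_form VJ)
  (is_derive_left sY (TX p) c0 dc) (is_derive_left sZ (TX p) c0 dc).
by rewrite c0.
Qed.

Lemma riemannian_metric_Str : riemannian_metric T (@metric_Str R V jmul e).
Proof.
split.
- move=> p a u v w _ _ _; rewrite !metric_StrE comp_lfunDr -comp_lfunZr.
  by rewrite (str_form_linear VJ).
- by move=> p u v _ _; rewrite !metric_StrE str_formC.
- move=> p _ [H sH ->] H0; rewrite metric_StrE Str_compVK.
  apply: (str_form_gt0 VJ) => //; apply: contra H0 => /eqP->.
  by rewrite comp_lfun0r.
- move=> X Y [sX TX] [sY TY].
  by apply: (smooth_bilinear (bounded_bilinear_str_form VJ));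
    exact: smooth_left.
Qed.

Lemma left_invariant_metric_Str : left_invariant (@metric_Str R V jmul e).
Proof.
move=> h g k kE _ _ [H _ ->] [K _ ->].
have hg (F : 'End(V)) : ((val k)^-1 \o (val h \o (val g \o F)))%VF = F.
  by rewrite (comp_lfunA (val h)) -kE Str_compVK.
by rewrite !metric_StrE !hg !Str_compVK.
Qed.

End LeviCivita.

Theorem theorem3p11 (R : realType) (V : vectType R) (jmul : V -> V -> V)
    (e : V) (VJ : euclidean_jordan_algebra jmul e) :
  [/\ riemannian_metric (@tangent_Str R V jmul) (@metric_Str R V jmul e),
      left_invariant (@metric_Str R V jmul e),
      forall (g : Str jmul) (x y : V) (D D' : 'End(V)),
        Der jmul D -> Der jmul D' ->
        metric_Str e g (val g \o (jL jmul x + D))%VF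
                       (val g \o (jL jmul y + D'))%VF =
        lfun_trace (jL jmul x \o jL jmul y)%VF - lfun_trace (D \o D')%VF
    & levi_civita (@tangent_Str R V jmul) (@metric_Str R V jmul e)
        (spray_connection (@spray_Str R V jmul e))].
Proof.
split.
- exact: riemannian_metric_Str.
- exact: left_invariant_metric_Str.
- by move=> g x y D D' dD dD'; rewrite metric_StrE !Str_compVK str_form_LD.
- split; [exact: affine_connection_nabla|exact: torsion_free_nabla|].
  exact: metric_compatible_nabla.
Qed.
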